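(* Let $R$ be a commutative noetherian local ring and $M$ a finitely generated $R$-module of finite G-dimension and infinite projective dimension. Let $G$ be a bounded proper G-resolution of $M$ and let $x=x_1,\ldots,x_c\in R$ be an $R$-regular and $M$-regular sequence with $c\geq 1$. If $K$ is the Koszul complex on $x$ over $R$, then the complex $G\otimes_R K$ is a G-resolution of $M/xM$, but it is not proper.
   Context: Let $R$ be a commutative noetherian local ring and set $(-)^*=\operatorname{Hom}_R(-,R)$. A finitely generated $R$-module $G$ is totally reflexive if the biduality map $G\to G^{**}$ is bijective and $\operatorname{Ext}^i_R(G,R)=0=\operatorname{Ext}^i_R(G^*,R)$ for all $i\neq 0$. A G-resolution of a finitely generated module $M$ is a complex $G$ of totally reflexive modules with $G_n=0$ for $n<0$, $H_n(G)=0$ for $n>0$ and $H_0(G)\cong M$; its augmented G-resolution $G^+$ is the exact sequence $\cdots\to G_1\to G_0\to M\to 0$. It is bounded if $G_n=0$ for $n\gg 0$. The G-dimension is $\operatorname{G-dim}_R(M)=\inf\{\sup\{n\geq 0\mid G_n\neq 0\}\mid G \text{ is a G-resolution of } M\}$. A G-resolution $G$ is proper if $\operatorname{Hom}_R(H,G^+)$ is exact for every totally reflexive $R$-module $H$. Regular sequences are understood in the usual sense, with all $x_i$ in the maximal ideal of $R$. *)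

(* Defs.v *)
From HB Require Import structures.
From mathcomp Require Import all_boot all_order all_algebra.
From mathcomp Require Import boolp classical_sets.
From mathcomp Require Import generic_quotient ring_quotient freeg.

Set Implicit Arguments.
Unset Strict Implicit.
Unset Printing Implicit Defensive.

Import GRing.Theory.
Local Open Scope ring_scope.
Local Open Scope quotient_scope.

Section Span.
Variables (R : comNzRingType) (V : lmodType R).
Implicit Types (A : set V).

Definition in_span A (v : V) : Prop :=
  exists n (a : 'I_n -> R) (u : 'I_n -> V),
    (forall i, A (u i)) /\ v = \sum_i a i *: u i.

Definition span A : {pred V} := fun v => `[< in_span A v >].

Lemma spanP A v : reflect (in_span A v) (v \in span A).
Proof. exact: asboolP. Qed.

Lemma span_submod_closed A : submod_closed (span A).
Proof.
split=> [|c _ _ /spanP[n [a [u [Au ->]]]] /spanP[p [b [w [Aw ->]]]]].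
  apply/spanP; exists 0%N, (fun=> 0), (fun=> 0); split; first by case.
  by rewrite big_ord0.
apply/spanP; exists (n + p)%N.
exists (fun i => match split i with inl j => c * a j | inr j => b j end).
exists (fun i => match split i with inl j => u j | inr j => w j end).
split=> [i|]; first by case: (split i).
rewrite big_split_ord scaler_sumr; congr (_ + _); apply: eq_bigr => i _.
  by rewrite (unsplitK (inl i)) scalerA.
by rewrite (unsplitK (inr i)).
Qed.

HB.instance Definition _ A :=
  GRing.isSubmodClosed.Build R V (span A)
    (span_submod_closed A).
Lemma mem_span A v : A v -> v \in span A.
Proof.
move=> Av; apply/spanP; exists 1%N, (fun=> 1), (fun=> v); split=> //.
by rewrite big_ord1 scale1r.
Qed.

Definition qmod A := Quotient.quot (span A).
HB.instance Definition _ A := GRing.Zmodule.on (qmod A).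
HB.instance Definition _ A :
  EqQuotient V (Quotient.equiv (span A)) (qmod A) := EqQuotient.on (qmod A).
HB.instance Definition _ A :
  @isZmodQuotient V (Quotient.equiv (span A)) 0 -%R +%R (qmod A) :=
  ZmodQuotient.on (qmod A).

Definition qproj A (v : V) : qmod A := \pi v.

Lemma qproj_eq A u v : (qproj A u = qproj A v) <-> (u - v \in span A).
Proof. by rewrite /qproj Quotient.idealrBE; split=> [->|/eqP]. Qed.

Lemma qprojP A (x : qmod A) : exists v, x = qproj A v.
Proof. by exists (repr x); rewrite /qproj reprK. Qed.

Fact qproj_zmod A : zmod_morphism (qproj A).
Proof. by move=> u v; rewrite /qproj !piE. Qed.

HB.instance Definition _ A :=
  GRing.isZmodMorphism.Build V (qmod A) (qproj A) (qproj_zmod A).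

Definition qscale A (c : R) (x : qmod A) : qmod A := qproj A (c *: repr x).

Lemma qscaleE A c v : qscale c (qproj A v) = qproj A (c *: v).
Proof.
apply/qproj_eq; rewrite -scalerBr rpredZ //; apply/qproj_eq.
by rewrite /qproj reprK.
Qed.

Fact qscaleA A c d (x : qmod A) : qscale c (qscale d x) = qscale (c * d) x.
Proof. by have [v ->] := qprojP x; rewrite !qscaleE scalerA. Qed.

Fact qscale1 A : left_id 1 (@qscale A).
Proof. by move=> x; have [v ->] := qprojP x; rewrite qscaleE scale1r. Qed.

Fact qscaleDr A : right_distributive (@qscale A) +%R.
Proof.
move=> c x y; have [[u ->] [v ->]] := (qprojP x, qprojP y).
by rewrite -raddfD !qscaleE scalerDr raddfD.
Qed.

Fact qscaleDl A (x : qmod A) : {morph (@qscale A)^~ x : c d / c + d}.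
Proof.
by move=> c d; have [v ->] := qprojP x; rewrite !qscaleE scalerDl raddfD.
Qed.

HB.instance Definition _ A := GRing.Zmodule_isLmodule.Build R (qmod A)
  (@qscaleA A) (@qscale1 A) (@qscaleDr A) (@qscaleDl A).

Fact qproj_scalable A : scalable (qproj A).
Proof. by move=> c v; rewrite -qscaleE. Qed.

HB.instance Definition _ A :=
  GRing.isScalable.Build R V (qmod A) *:%R (qproj A) (@qproj_scalable A).

End Span.

Section QuotientLift.
Variables (R : comNzRingType) (V W : lmodType R) (A : set V).
Variables (f : {linear V -> W}) (fA : forall v, A v -> f v = 0).

Definition qlift (x : qmod A) : W := f (repr x).

Lemma qliftE v : qlift (qproj A v) = f v.
Proof.
suff fspan u : u \in span A -> f u = 0.
  apply/eqP; rewrite -subr_eq0 -linearB /=; apply/eqP/fspan/qproj_eq.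
  by rewrite /qproj reprK.
move=> /spanP[n [a [w [Aw ->]]]]; rewrite linear_sum big1 // => i _.
by rewrite linearZ /= fA // scaler0.
Qed.

Fact qlift_linear : linear qlift.
Proof.
move=> c x y; have [[u ->] [v ->]] := (qprojP x, qprojP y).
by rewrite -linearP !qliftE linearP.
Qed.

End QuotientLift.

(* {linear V -> W} is the module Hom_R(V, W), with pointwise operations. *)
Section HomModule.
Variables (R : comNzRingType) (V W : lmodType R).
Implicit Types f g h : {linear V -> W}.

Lemma lin_ext f g : (forall x, f x = g x) -> f = g.
Proof.
case: f g => [f [[f1] [f2]]] [g [[g1] [g2]]] /= fg.
have E : f = g by apply/funext => x; exact: fg.
case: g / E in g1 g2 fg *.
by rewrite (Prop_irrelevance f1 g1) (Prop_irrelevance f2 g2).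
Qed.

HB.instance Definition _ := gen_eqMixin {linear V -> W}.
HB.instance Definition _ := gen_choiceMixin {linear V -> W}.

Definition lin0 : {linear V -> W} := \0.
Definition linD f g : {linear V -> W} := f \+ g.
Definition linN f : {linear V -> W} := \- f.
Definition linZ c f : {linear V -> W} := c \*: f.

Fact linDA : associative linD.
Proof. by move=> f g h; apply: lin_ext => x /=; rewrite addrA. Qed.
Fact linDC : commutative linD.
Proof. by move=> f g; apply: lin_ext => x /=; rewrite addrC. Qed.
Fact lin0D : left_id lin0 linD.
Proof. by move=> f; apply: lin_ext => x /=; rewrite add0r. Qed.
Fact linND : left_inverse lin0 linN linD.
Proof. by move=> f; apply: lin_ext => x /=; rewrite addNr. Qed.

HB.instance Definition _ := GRing.isZmodule.Build {linear V -> W}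
  linDA linDC lin0D linND.

Fact linZA c d f : linZ c (linZ d f) = linZ (c * d) f.
Proof. by apply: lin_ext => x /=; rewrite scalerA. Qed.
Fact lin1Z : left_id 1 linZ.
Proof. by move=> f; apply: lin_ext => x /=; rewrite scale1r. Qed.
Fact linZDr : right_distributive linZ +%R.
Proof. by move=> c f g; apply: lin_ext => x /=; rewrite scalerDr. Qed.
Fact linZDl f : {morph linZ^~ f : c d / c + d}.
Proof. by move=> c d; apply: lin_ext => x /=; rewrite scalerDl. Qed.

HB.instance Definition _ := GRing.Zmodule_isLmodule.Build R {linear V -> W}
  linZA lin1Z linZDr linZDl.

End HomModule.

Section Postcomposition.
Variables (R : comNzRingType) (H V W : lmodType R) (f : {linear V -> W}).

Definition postcomp (g : {linear H -> V}) : {linear H -> W} := f \o g.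

Fact postcomp_linear : linear postcomp.
Proof. by move=> c g h; apply: lin_ext => x /=; rewrite linearP. Qed.

HB.instance Definition _ := GRing.isLinear.Build R {linear H -> V}
  {linear H -> W} *:%R postcomp postcomp_linear.

End Postcomposition.

Section Biduality.
Variable R : comNzRingType.

Definition dualmod (V : lmodType R) : lmodType R := {linear V -> R^o}.

Variable V : lmodType R.

Definition evalat (v : V) (f : dualmod V) : R^o := (f : {linear V -> R^o}) v.

Fact evalat_linear v : linear (evalat v).
Proof. by []. Qed.

HB.instance Definition _ v := GRing.isLinear.Build R (dualmod V) R^o *:%R
  (evalat v) (evalat_linear v).

Definition biduality (v : V) : dualmod (dualmod V) :=
  evalat v : {linear _ -> _}.

Fact biduality_linear : linear biduality.
Proof.
move=> c u v; apply: lin_ext => f.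
by rewrite /= /evalat linearP.
Qed.

HB.instance Definition _ := GRing.isLinear.Build R V (dualmod (dualmod V)) *:%R
  biduality biduality_linear.

End Biduality.

Section FreeLift.
Variables (R : comNzRingType) (K : choiceType) (W : lmodType R) (f : K -> W).

Definition frlift (D : {freeg K / R}) : W := fglift f D.

Fact frlift_zmod : zmod_morphism frlift.
Proof. exact: lift_is_additive. Qed.

HB.instance Definition _ :=
  GRing.isZmodMorphism.Build {freeg K / R} W frlift frlift_zmod.

Lemma frliftE x : frlift << x >> = f x.
Proof. by rewrite /frlift liftU scale1r. Qed.

Fact frlift_scalable : scalable frlift.
Proof.
move=> c D; rewrite -[D in RHS]freeg_sumE.
have -> : c *: D = \sum_(x <- dom D) << c * coeff x D *g x >> by [].
rewrite !raddf_sum /=.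
by apply: eq_bigr => i _; rewrite /frlift !liftU scalerA.
Qed.

HB.instance Definition _ := GRing.isScalable.Build R {freeg K / R} W *:%R
  frlift frlift_scalable.

End FreeLift.

Section Tensor.
Variables (R : comNzRingType) (V W : lmodType R).

Definition fpure (v : V) (w : W) : {freeg (V * W)%type / R} := << (v, w) >>.

Definition bilinear_rel : set {freeg (V * W)%type / R} := fun D =>
  [\/ exists v v' w, D = fpure (v + v') w - fpure v w - fpure v' w,
      exists v w w', D = fpure v (w + w') - fpure v w - fpure v w',
      exists c v w, D = fpure (c *: v) w - c *: fpure v w |
      exists c v w, D = fpure v (c *: w) - c *: fpure v w].

Definition tensor := qmod bilinear_rel.
HB.instance Definition _ := GRing.Lmodule.on tensor.

Definition tpure (v : V) (w : W) : tensor := qproj bilinear_rel (fpure v w).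

Lemma tpureP v w : (forall v', tpure (v + v') w = tpure v w + tpure v' w) /\
  (forall w', tpure v (w + w') = tpure v w + tpure v w') /\
  (forall c, tpure (c *: v) w = c *: tpure v w) /\
  (forall c, tpure v (c *: w) = c *: tpure v w).
Proof.
split; [|split; [|split]] => [v'|w'|c|c]; rewrite /tpure -?linearD -?linearZ;
  apply/qproj_eq/mem_span; rewrite ?opprD ?addrA.
- by apply: Or41; exists v, v', w.
- by apply: Or42; exists v, w, w'.
- by apply: Or43; exists c, v, w.
- by apply: Or44; exists c, v, w.
Qed.

Lemma tensor_ext (U : lmodType R) (f g : {linear tensor -> U}) :
  (forall v w, f (tpure v w) = g (tpure v w)) -> forall t, f t = g t.
Proof.
move=> fg t; have [D ->] := qprojP t; rewrite -[D]freeg_sumE !linear_sum.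
apply: eq_bigr => -[v w] _.
have -> : << coeff (v, w) D *g (v, w) >> = coeff (v, w) D *: fpure v w.
  by apply/eqP/freeg_eqP => z; rewrite coeffZ !coeffU mul1r.
by rewrite !linearZ /= fg.
Qed.

End Tensor.

Section TensorMap.
Variables (R : comNzRingType) (V V' W W' : lmodType R).
Variables (f : {linear V -> V'}) (g : {linear W -> W'}).

Definition tmap_gen (p : V * W) : tensor V' W' := tpure (f p.1) (g p.2).

Fact tmap_genP D : bilinear_rel D -> frlift tmap_gen D = 0.
Proof.
have E v w : frlift tmap_gen (fpure v w) = tpure (f v) (g w).
  exact: frliftE.
case=> [[v [v' [w]]]|[v [w [w']]]|[c [v [w]]]|[c [v [w]]]] ->;
  have [Dl [Dr [Zl Zr]]] := tpureP (f v) (g w);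
  rewrite !(linearB, linearZ) /= !E !(linearD, linearZ) /= ?Dl ?Dr ?Zl ?Zr.
- by rewrite -addrA -opprD subrr.
- by rewrite -addrA -opprD subrr.
- by rewrite scalerN subrr.
- by rewrite scalerN subrr.
Qed.

Definition tmap : tensor V W -> tensor V' W' := qlift (frlift tmap_gen).

Lemma tmapE v w : tmap (tpure v w) = tpure (f v) (g w).
Proof. by rewrite /tmap (qliftE tmap_genP) [LHS]frliftE. Qed.

Fact tmap_linear : linear tmap.
Proof. exact: qlift_linear tmap_genP. Qed.

HB.instance Definition _ := GRing.isLinear.Build R (tensor V W)
  (tensor V' W') *:%R tmap tmap_linear.

Lemma tmapD s t : tmap (s + t) = tmap s + tmap t.
Proof. exact: linearD. Qed.

Lemma tmapZ c t : tmap (c *: t) = c *: tmap t.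
Proof. exact: linearZ. Qed.

End TensorMap.

Section TensorMapTheory.
Variables (R : comNzRingType) (V V' V'' W W' W'' : lmodType R).
Implicit Types (f : {linear V -> V'}) (g : {linear W -> W'}).

Lemma eq_tmap f f' g g' t : f =1 f' -> g =1 g' -> tmap f g t = tmap f' g' t.
Proof.
move=> ff gg; apply: (tensor_ext (f := tmap f g) (g := tmap f' g')) => v w.
by rewrite /= !tmapE ff gg.
Qed.

Lemma tmap_comp f g (f' : {linear V' -> V''}) (g' : {linear W' -> W''}) t :
  tmap f' g' (tmap f g t) = tmap (f' \o f) (g' \o g) t.
Proof.
apply: (tensor_ext (f := tmap f' g' \o tmap f g) (g := tmap _ _)) => v w.
by rewrite /= !tmapE.
Qed.

Lemma tmap0l f g t : (forall v, f v = 0) -> tmap f g t = 0.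
Proof.
move=> f0; apply: (tensor_ext (f := tmap f g) (g := \0)) => v w.
by rewrite /= tmapE f0 -(scale0r 0) (tpureP _ _).2.2.1 scale0r.
Qed.

Lemma tmap0r f g t : (forall w, g w = 0) -> tmap f g t = 0.
Proof.
move=> g0; apply: (tensor_ext (f := tmap f g) (g := \0)) => v w.
by rewrite /= tmapE g0 -(scale0r 0) (tpureP _ _).2.2.2 scale0r.
Qed.

End TensorMapTheory.

(* The direct product of the T i, which is their direct sum for finite I. *)
Section DependentProduct.
Variables (R : comNzRingType) (I : Type) (T : I -> lmodType R).

Definition dprodmod := forall i, T i.
Implicit Types s t : dprodmod.

HB.instance Definition _ := gen_eqMixin dprodmod.
HB.instance Definition _ := gen_choiceMixin dprodmod.

Lemma dprod_ext s t : (forall i, s i = t i) -> s = t.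
Proof. exact: functional_extensionality_dep. Qed.

Definition dprod0 : dprodmod := fun=> 0.
Definition dprodD s t : dprodmod := fun i => s i + t i.
Definition dprodN s : dprodmod := fun i => - s i.
Definition dprodZ (c : R) s : dprodmod := fun i => c *: s i.

Fact dprodDA : associative dprodD.
Proof. by move=> s t u; apply: dprod_ext => i; rewrite /dprodD addrA. Qed.
Fact dprodDC : commutative dprodD.
Proof. by move=> s t; apply: dprod_ext => i; rewrite /dprodD addrC. Qed.
Fact dprod0D : left_id dprod0 dprodD.
Proof. by move=> s; apply: dprod_ext => i; rewrite /dprodD add0r. Qed.
Fact dprodND : left_inverse dprod0 dprodN dprodD.
Proof. by move=> s; apply: dprod_ext => i; rewrite /dprodD addNr. Qed.

HB.instance Definition _ := GRing.isZmodule.Build dprodmod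
  dprodDA dprodDC dprod0D dprodND.

Fact dprodZA c d s : dprodZ c (dprodZ d s) = dprodZ (c * d) s.
Proof. by apply: dprod_ext => i; rewrite /dprodZ scalerA. Qed.
Fact dprod1Z : left_id 1 dprodZ.
Proof. by move=> s; apply: dprod_ext => i; rewrite /dprodZ scale1r. Qed.
Fact dprodZDr : right_distributive dprodZ +%R.
Proof. by move=> c s t; apply: dprod_ext => i; rewrite /dprodZ scalerDr. Qed.
Fact dprodZDl s : {morph dprodZ^~ s : c d / c + d}.
Proof. by move=> c d; apply: dprod_ext => i; rewrite /dprodZ scalerDl. Qed.

HB.instance Definition _ := GRing.Zmodule_isLmodule.Build R dprodmod
  dprodZA dprod1Z dprodZDr dprodZDl.

End DependentProduct.

(* Chain complexes concentrated in degrees n >= 0, with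
   [cdiff C n : C n.+1 -> C n]. *)
Record complex (R : comNzRingType) := Complex {
  cobj :> nat -> lmodType R;
  cdiff : forall n, {linear cobj n.+1 -> cobj n};
  cdiffK : forall n x, cdiff n (cdiff n.+1 x) = 0
}.

Arguments cdiff {R} C n : rename.

Section TensorComplex.
Variables (R : comNzRingType) (C D : complex R).

(* Indexing by bidegrees, rather than by i with j := n - i, avoids casts. *)
Definition bideg n := {p : nat * nat | p.1 + p.2 == n}%N.

Definition shl n (p : bideg n) : bideg n.+1 :=
  exist _ ((val p).1.+1, (val p).2) (valP p).

Fact shr_subproof n (p : bideg n) : ((val p).1 + (val p).2.+1 == n.+1)%N.
Proof. by rewrite addnS; exact: (valP p). Qed.

Definition shr n (p : bideg n) : bideg n.+1 :=
  exist _ ((val p).1, (val p).2.+1) (shr_subproof p).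

Definition tens_obj n : lmodType R :=
  dprodmod (fun p : bideg n => tensor (C (val p).1) (D (val p).2)).

(* The (i, j) component of the differential
   d(u (x) v) = du (x) v + (-1)^i u (x) dv, for u in C_i. *)
Definition tens_comp i j (a : tensor (C i.+1) (D j))
    (b : tensor (C i) (D j.+1)) : tensor (C i) (D j) :=
  tmap (cdiff C i) idfun a + (-1) ^+ i *: tmap idfun (cdiff D j) b.

Fact tens_comp_linear i j c (a a' : tensor (C i.+1) (D j)) b b' :
  tens_comp (c *: a + a') (c *: b + b') = c *: tens_comp a b + tens_comp a' b'.
Proof.
rewrite /tens_comp !tmapD !tmapZ !scalerDr !scalerA [_ * c]mulrC.
by rewrite addrACA.
Qed.

Fact tens_compK i j (a : tensor (C i.+2) (D j)) b (c : tensor (C i) (D j.+2)) :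
  tens_comp (tens_comp a b) (tens_comp b c) = 0.
Proof.
have lK : tmap (cdiff C i) idfun (tmap (cdiff C i.+1) idfun a) = 0.
  rewrite tmap_comp; apply: tmap0l => x; exact: cdiffK.
have rK : tmap idfun (cdiff D j) (tmap idfun (cdiff D j.+1) c) = 0.
  rewrite tmap_comp; apply: tmap0r => x; exact: cdiffK.
have lr : tmap (cdiff C i) idfun (tmap idfun (cdiff D j) b)
    = tmap idfun (cdiff D j) (tmap (cdiff C i) idfun b).
  by rewrite !tmap_comp; apply: eq_tmap.
rewrite /tens_comp !tmapD !tmapZ lK lr rK scaler0 addr0 add0r.
by rewrite exprS mulN1r scaleNr addNr.
Qed.

Definition tens_diff n (t : tens_obj n.+1) : tens_obj n :=
  fun p => tens_comp (t (shl p)) (t (shr p)).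

Fact tens_diff_linear n : linear (@tens_diff n).
Proof. by move=> c s t; apply: dprod_ext => p; exact: tens_comp_linear. Qed.

HB.instance Definition _ n := GRing.isLinear.Build R (tens_obj n.+1)
  (tens_obj n) *:%R (@tens_diff n) (@tens_diff_linear n).

Fact tens_diffK n (t : tens_obj n.+2) : tens_diff (tens_diff t) = 0.
Proof.
apply: dprod_ext => p.
have irr q (h h' : (q.1 + q.2 == n.+2)%N) : t (exist _ q h) = t (exist _ q h').
  by rewrite (bool_irrelevance h h').
have tE : t (shr (shl p)) = t (shl (shr p)) :>
    tensor (C (val p).1.+1) (D (val p).2.+1).
  by exact: (irr ((val p).1.+1, (val p).2.+1)).
have := tens_compK (t (shl (shl p))) (t (shl (shr p))) (t (shr (shr p))).
by rewrite -{1}tE.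
Qed.

Definition tensor_complex : complex R :=
  Complex (cdiff := fun n => @tens_diff n : {linear _ -> _}) tens_diffK.

End TensorComplex.

Section Koszul.
Variable R : comNzRingType.

Definition mod0 : lmodType R := 'rV[R]_0.

Definition one_obj (n : nat) : lmodType R := if n is 0 then R^o else mod0.
Definition one_diff n : {linear one_obj n.+1 -> one_obj n} := \0.
Fact one_diffK n (t : one_obj n.+2) : one_diff n (one_diff n.+1 t) = 0.
Proof. by []. Qed.

Definition one_complex : complex R := Complex one_diffK.

Definition koszul1_obj (n : nat) : lmodType R :=
  if n is (0 | 1) then R^o else mod0.
Definition koszul1_diff (a : R) n :
    {linear koszul1_obj n.+1 -> koszul1_obj n} :=
  match n with
  | 0 => a \*: (idfun : {linear R^o -> R^o})
  | _ => \0
  end.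
Fact koszul1_diffK a n (t : koszul1_obj n.+2) :
  koszul1_diff a n (koszul1_diff a n.+1 t) = 0.
Proof. by case: n t => [|n] t //=; rewrite scaler0. Qed.

(* 0 -> R -> R -> 0 in degrees 1 and 0, with differential r |-> a r. *)
Definition koszul1 (a : R) : complex R := Complex (koszul1_diffK a).

(* K(x_1, ..., x_c) = K(x_1) (x) ... (x) K(x_c) (x) R. *)
Definition koszul (x : seq R) : complex R :=
  foldr (fun a => tensor_complex (koszul1 a)) one_complex x.

End Koszul.

Section Homological.
Variable R : comNzRingType.
Implicit Types (M N P G H : lmodType R) (C : complex R).

(* Exactness of ... -> C_1 -> C_0 -> 0. *)
Definition exact_complex C : Prop :=
  (forall y : C 0, exists x, cdiff C 0 x = y) /\
  (forall n (y : C n.+1), cdiff C n y = 0 -> exists x, cdiff C n.+1 x = y).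

Record augmentation C M := Augmentation {
  aug :> {linear C 0 -> M};
  augK : forall x, aug (cdiff C 0 x) = 0
}.

Section Augmented.
Variables (C : complex R) (M : lmodType R) (e : augmentation C M).

Definition augmented_obj (n : nat) : lmodType R := if n is k.+1 then C k else M.
Definition augmented_diff n :
    {linear augmented_obj n.+1 -> augmented_obj n} :=
  match n with 0 => e | k.+1 => cdiff C k end.
Fact augmented_diffK n (x : augmented_obj n.+2) :
  augmented_diff n (augmented_diff n.+1 x) = 0.
Proof. by case: n x => [|n] x; [exact: augK | exact: cdiffK]. Qed.

Definition augmented : complex R := Complex augmented_diffK.

End Augmented.

Section HomComplex.
Variables (H : lmodType R) (C : complex R).

Definition hom_obj (n : nat) : lmodType R := {linear H -> C n}.
Definition hom_diff n : {linear hom_obj n.+1 -> hom_obj n} :=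
  postcomp (H := H) (cdiff C n).
Fact hom_diffK n (f : hom_obj n.+2) : hom_diff n (hom_diff n.+1 f) = 0.
Proof. by apply: lin_ext => x; exact: cdiffK. Qed.

Definition hom_complex : complex R := Complex hom_diffK.

End HomComplex.

Definition is_zero M : Prop := forall x : M, x = 0.

Definition bounded_complex C : Prop :=
  exists n, forall k, (n < k)%N -> is_zero (C k).

Definition finitely_generated M : Prop :=
  exists n (u : 'I_n -> M), forall v, v \in span (range u).

Definition projective P : Prop :=
  forall (M N : lmodType R) (p : {linear M -> N}) (f : {linear P -> N}),
    (forall y, exists x, p x = y) -> exists g : {linear P -> M}, f =1 p \o g.

Definition projective_resolution C M (e : augmentation C M) : Prop :=
  (forall n, projective (C n)) /\ exact_complex (augmented e).

(* Ext^(n+1)_R(M, N) = 0: the cohomology of Hom_R(C, N) in degree n + 1 vanishes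
   for a projective resolution C of M; this does not depend on C. *)
Definition ExtS_eq0 (n : nat) M N : Prop :=
  exists C (e : augmentation C M), projective_resolution e /\
    forall f : {linear C n.+1 -> N}, f \o cdiff C n.+1 =1 \0 ->
      exists g : {linear C n -> N}, f =1 g \o cdiff C n.

Definition totally_reflexive G : Prop :=
  [/\ finitely_generated G,
      bijective (@biduality R G),
      forall n, ExtS_eq0 n G R^o &
      forall n, ExtS_eq0 n (dualmod G) R^o].

(* The augmentation e induces the isomorphism H_0(C) = M. *)
Definition G_resolution C M (e : augmentation C M) : Prop :=
  (forall n, totally_reflexive (C n)) /\ exact_complex (augmented e).

Definition proper_G_resolution C M (e : augmentation C M) : Prop :=
  G_resolution e /\
  forall H, totally_reflexive H -> exact_complex (hom_complex H (augmented e)).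

(* G-dim M <= n, resp. pd M <= n. The infimum over all resolutions is attained
   when it is finite, so finiteness is [exists n, Gdim_le M n]. *)
Definition Gdim_le M (n : nat) : Prop :=
  exists C (e : augmentation C M),
    G_resolution e /\ forall k, (n < k)%N -> is_zero (C k).

Definition pdim_le M (n : nat) : Prop :=
  exists C (e : augmentation C M),
    projective_resolution e /\ forall k, (n < k)%N -> is_zero (C k).

(* R^o and its submodules are used for R as a module and for its ideals. *)
Definition noetherian : Prop :=
  forall I : {pred R^o}, submod_closed I ->
    exists n (u : 'I_n -> R^o), I =i span (range u).

Definition maximal_ideal (I : {pred R^o}) : Prop :=
  [/\ submod_closed I, 1 \notin I &
      forall J : {pred R^o}, submod_closed J -> {subset I <= J} ->
        1 \notin J -> J =i I].

Definition local_ring (m : {pred R^o}) : Prop :=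
  maximal_ideal m /\ forall I, maximal_ideal I -> I =i m.

(* These products a *: u generate sM, so that qseq M s is M / sM. *)
Definition seq_mul (s : seq R) M : set M :=
  [set v | exists2 a, a \in s & exists u, v = a *: u].

Definition qseq M (s : seq R) : lmodType R := qmod (@seq_mul s M).

Definition nonzerodivisor M (a : R) : Prop := forall u : M, a *: u = 0 -> u = 0.

Definition regular_sequence M (s : seq R) : Prop :=
  (forall i, (i < size s)%N -> nonzerodivisor (qseq M (take i s)) s`_i) /\
  ~ is_zero (qseq M s).

End Homological.

(* Main.v *)
(* Let I = (x). The complex G (x) K is an iterated mapping cone, one for each x_i,
   of multiplication by x_i. The recursive definition of K makes x_1 the last
   cone, so exactness needs x_i to be regular on M / (x_(i+1), ..., x_c) M; this
   holds because regular sequences in the maximal ideal can be permuted.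

   If G (x) K were proper, exactness of Hom(H, -) in degree 0 would lift every map
   H -> M/IM from a totally reflexive H to M. Put N = M / (x_1, ..., x_(c-1)) M
   and a = x_c, and call a map H -> N stably zero if it lifts to a free cover of
   N. Lifting along N -> N/aN makes a injective on Hom(H, N) modulo stably zero
   maps, for every H. Applied to the pullback Q of a free cover P -> H along
   a : H -> H, on which a times the projection Q -> H factors through P, this
   shows that a is also surjective there; by Nakayama all maps H -> N are stably
   zero. They therefore lift to M, the argument applies to x_1, ..., x_(c-1), and
   finally every map from a totally reflexive module to M is stably zero. This
   property passes to syzygies, one of which is totally reflexive since G is
   bounded; its identity map is then stably zero, so it is projective and M has
   finite projective dimension. *)
From HB Require Import structures.
From mathcomp Require Import all_boot all_order all_algebra.
From mathcomp Require Import boolp classical_sets freeg.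
Require Import Defs.

Set Implicit Arguments.
Unset Strict Implicit.
Unset Printing Implicit Defensive.

Import GRing.Theory.
Local Open Scope ring_scope.

(** * Linear maps, kernels and projective modules *)

Section Linear.
Variable R : comNzRingType.

(* Sealed, so that neither simplification nor unification sees through it. *)
Fact mklin_subproof (U V : lmodType R) (f : U -> V) :
  linear f -> {g : {linear U -> V} | g =1 f}.
Proof.
move=> h; pose g : {linear U -> V} :=
  HB.pack f (GRing.isLinear.Build R U V *:%R f h).
by exists g.
Qed.

Definition mklin (U V : lmodType R) (f : U -> V) (h : linear f) :
    {linear U -> V} := sval (mklin_subproof h).

Lemma mklinE (U V : lmodType R) (f : U -> V) (h : linear f) x :
  mklin h x = f x.
Proof. exact: (svalP (mklin_subproof h)). Qed.

Section Kernel.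
Variables (U V : lmodType R) (f : {linear U -> V}).

Definition ker_pred : {pred U} := fun u => f u == 0.

Lemma ker_submod_closed : submod_closed ker_pred.
Proof.
split=> [|c u v]; first by rewrite unfold_in linear0.
by rewrite !unfold_in linearP => /eqP-> /eqP->; rewrite scaler0 addr0.
Qed.

HB.instance Definition _ :=
  GRing.isSubmodClosed.Build R U ker_pred ker_submod_closed.

Record kernel_of := Kernel_of { kerval : U; kervalP : kerval \in ker_pred }.
HB.instance Definition _ := [isSub for kerval].
HB.instance Definition _ := [Choice of kernel_of by <:].
HB.instance Definition _ := [SubChoice_isSubLmodule of kernel_of by <:].

Definition kern : lmodType R := kernel_of.

Definition kinj : {linear kern -> U} :=
  mklin (f := kerval) (fun _ _ _ => erefl).

Lemma kinj_inj : injective kinj.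
Proof. by move=> k l; rewrite /kinj !mklinE; exact: val_inj. Qed.

Lemma kinjK k : f (kinj k) = 0.
Proof. by rewrite /kinj mklinE; apply/eqP; exact: (valP k). Qed.

Lemma kerE u : f u = 0 -> exists k : kern, kinj k = u.
Proof.
by move=> /eqP fu; exists (Kernel_of (fu : u \in ker_pred)); rewrite /kinj mklinE.
Qed.

End Kernel.
Arguments kinj {U V} f.

Section Factor.

(** The section [s] comes from choice and need not be linear; [f \o s] is, since [f] is constant on
    the fibres of [p]. *)
Lemma factor_surj (U V W : lmodType R) (p : {linear U -> V})
    (f : {linear U -> W}) :
  (forall v, exists u, p u = v) -> (forall u, p u = 0 -> f u = 0) ->
  exists g : {linear V -> W}, forall u, g (p u) = f u.
Proof.
move=> /choice[s ps] pf.
have E u v : p u = p v -> f u = f v.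
  by move=> e; apply/eqP; rewrite -subr_eq0 -linearB pf // linearB /= e subrr.
have lin : linear (f \o s).
  by move=> c u v /=; rewrite -linearP; apply: E; rewrite linearP !ps.
by exists (mklin lin) => u; rewrite mklinE; apply: E; rewrite ps.
Qed.

Lemma factor_inj (U V W : lmodType R) (i : {linear U -> V})
    (f : {linear W -> V}) :
  injective i -> (forall w, exists u, i u = f w) ->
  exists g : {linear W -> U}, forall w, i (g w) = f w.
Proof.
move=> inj /choice[s is_].
have lin : linear s by move=> c u v; apply: inj; rewrite linearP !is_ linearP.
by exists (mklin lin) => w; rewrite mklinE is_.
Qed.

End Factor.

Definition prodm (U V : lmodType R) : lmodType R := (U * V)%type.

Section Product.
Variables U V : lmodType R.

Definition pairm (u : U) (v : V) : prodm U V := (u, v).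

Definition lfst : {linear prodm U V -> U} :=
  mklin (f := @fst U V : prodm U V -> U) (fun _ _ _ => erefl).
Definition lsnd : {linear prodm U V -> V} :=
  mklin (f := @snd U V : prodm U V -> V) (fun _ _ _ => erefl).

Fact linl_linear : linear (pairm^~ 0).
Proof. by move=> c u v; congr pair => /=; rewrite scaler0 addr0. Qed.
Fact linr_linear : linear (pairm 0).
Proof. by move=> c u v; congr pair => /=; rewrite scaler0 addr0. Qed.
Definition linl : {linear U -> prodm U V} := mklin linl_linear.
Definition linr : {linear V -> prodm U V} := mklin linr_linear.

Lemma lfstE u v : lfst (pairm u v) = u. Proof. exact: mklinE. Qed.
Lemma lsndE u v : lsnd (pairm u v) = v. Proof. exact: mklinE. Qed.
Lemma linlE u : linl u = pairm u 0. Proof. exact: mklinE. Qed.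
Lemma linrE v : linr v = pairm 0 v. Proof. exact: mklinE. Qed.

Lemma pairm_eta x : x = pairm (lfst x) (lsnd x).
Proof. by rewrite /lfst /lsnd !mklinE; case: x. Qed.

Lemma prodm_ext x y : lfst x = lfst y -> lsnd x = lsnd y -> x = y.
Proof. by move=> e1 e2; rewrite [x]pairm_eta [y]pairm_eta e1 e2. Qed.

End Product.
Arguments lfst {U V}.
Arguments lsnd {U V}.
Arguments linl {U V}.
Arguments linr {U V}.

Section RowVectors.
Variables (n : nat) (V : lmodType R).

Fact rvlift_linear (u : 'I_n -> V) :
  linear (fun y : 'rV[R]_n => \sum_i y 0 i *: u i).
Proof.
move=> c y z; rewrite scaler_sumr -big_split; apply: eq_bigr => i _.
by rewrite !mxE scalerDl scalerA.
Qed.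

Definition rvlift (u : 'I_n -> V) : {linear 'rV[R]_n -> V} :=
  mklin (rvlift_linear u).

Lemma rvliftE (p : {linear 'rV[R]_n -> V}) y :
  p y = \sum_i y 0 i *: p (delta_mx 0 i).
Proof. by rewrite {1}[y]row_sum_delta linear_sum; under eq_bigr do rewrite linearZ. Qed.

Lemma rvlift_delta u i : rvlift u (delta_mx 0 i) = u i.
Proof.
rewrite /rvlift mklinE (bigD1 i) //= mxE !eqxx scale1r big1 ?addr0 // => j ji.
by rewrite mxE (negPf ji) andbF scale0r.
Qed.

End RowVectors.

Definition surjective (U V : Type) (f : U -> V) := forall v, exists u, f u = v.

Section Exactness.

Definition ses (A B C : lmodType R) (i : {linear A -> B})
    (p : {linear B -> C}) : Prop :=
  [/\ injective i, surjective p, forall a, p (i a) = 0 &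
      forall b, p b = 0 -> exists a, i a = b].

Lemma ses_kinj (U V : lmodType R) (p : {linear U -> V}) :
  surjective p -> ses (kinj p) p.
Proof.
by move=> sp; split=> //; [exact: kinj_inj | exact: kinjK | exact: kerE].
Qed.

Lemma ses_prod (U V : lmodType R) : ses (@linl U V) lsnd.
Proof.
split=> [u v|v|u|x x0]; first by rewrite !linlE => -[].
- by exists (linr v); rewrite linrE lsndE.
- by rewrite linlE lsndE.
- by exists (lfst x); apply: prodm_ext; rewrite linlE ?lfstE ?lsndE.
Qed.

Lemma ker0_inj (U V : lmodType R) (f : {linear U -> V}) :
  (forall u, f u = 0 -> u = 0) -> injective f.
Proof.
move=> f0 u v e; apply/eqP; rewrite -subr_eq0; apply/eqP/f0.
by rewrite linearB /= e subrr.
Qed.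

End Exactness.

Section Projective.

Lemma projective_split (P V : lmodType R) (p : {linear V -> P}) :
  projective P -> surjective p ->
  exists s : {linear P -> V}, forall x, p (s x) = x.
Proof.
by move=> prP sp; have [s ps] := prP _ _ p idfun sp; exists s => x; exact/esym/ps.
Qed.

Lemma projective_retract (P Q : lmodType R) (i : {linear Q -> P})
    (r : {linear P -> Q}) :
  (forall x, r (i x) = x) -> projective P -> projective Q.
Proof.
move=> ri prP M N p f sp; have [g fg] := prP _ _ p (f \o r) sp.
by exists (g \o i) => x; have /= <- := fg (i x); rewrite ri.
Qed.

Lemma projective_prod (P Q : lmodType R) :
  projective P -> projective Q -> projective (prodm P Q).
Proof.
move=> prP prQ M N p f sp.
have [g fg] := prP _ _ p (f \o linl) sp.
have [h fh] := prQ _ _ p (f \o linr) sp.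
exists ((g \o lfst) \+ (h \o lsnd)) => x /=.
rewrite linearD; have /= <- := fg (lfst x); have /= <- := fh (lsnd x).
rewrite -linearD; congr (f _).
by apply: prodm_ext; rewrite linearD ?linlE ?linrE ?lfstE ?lsndE ?addr0 ?add0r.
Qed.

Lemma projective_is_zero (P : lmodType R) : is_zero P -> projective P.
Proof.
move=> P0 M N p f sp; exists \0 => x.
by rewrite /= (P0 x) !linear0.
Qed.

Lemma projective_rV n : projective 'rV[R]_n.
Proof.
move=> M N p f sp.
have /choice[g pg] i : exists v, p v = f (delta_mx 0 i) by exact: sp.
exists (rvlift g) => y; rewrite rvliftE [RHS]rvliftE.
by apply: eq_bigr => i _; rewrite /= rvlift_delta pg.
Qed.

Lemma projective_iso (P Q : lmodType R) (f : {linear P -> Q}) :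
  injective f -> surjective f -> projective P -> projective Q.
Proof.
move=> fi fs; have [|g fg] := @factor_inj _ _ _ f idfun fi.
  by move=> w; have [u <-] := fs w; exists u.
by apply: (projective_retract (i := g) (r := f)) => x; rewrite fg.
Qed.

Lemma projective_freeg (K : choiceType) : projective {freeg K / R}.
Proof.
move=> M N p f sp.
have /choice[g pg] x : exists v, p v = f << x >> by exact: sp.
exists (frlift g) => D /=; rewrite -[D]freeg_sumE !linear_sum.
apply: eq_bigr => x _.
have -> : << coeff x D *g x >> = coeff x D *: (<< x >> : {freeg K / R}).
  by apply/eqP/freeg_eqP => z; rewrite coeffZ !coeffU mul1r.
by rewrite !linearZ /= frliftE pg.
Qed.

(** Every element of [M] is a basis vector, so this cover needs no finiteness. *)
Definition frcover (M : lmodType R) : {linear {freeg M / R} -> M} := frlift id.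

Lemma frcover_surj M : surjective (frcover M).
Proof. by move=> v; exists << v >>; exact: frliftE. Qed.

End Projective.
End Linear.
Arguments kinj {R U V} f.
Arguments lfst {R U V}.
Arguments lsnd {R U V}.
Arguments linl {R U V}.
Arguments linr {R U V}.
Arguments surjective {U V} f /.

(** * Vanishing of Ext(-, R) *)

Section Ext.
Variable R : comNzRingType.
Implicit Types A B C E K L M P W : lmodType R.

(** Elementwise form of the fibre product: the second clause gives a point over each compatible
    pair, and the third makes it unique. *)
Definition is_pullback E B C W (f : {linear E -> C}) (g : {linear B -> C})
    (w1 : {linear W -> E}) (w2 : {linear W -> B}) : Prop :=
  [/\ forall w, f (w1 w) = g (w2 w),
      forall x y, f x = g y -> exists w, w1 w = x /\ w2 w = y &
      forall w, w1 w = 0 -> w2 w = 0 -> w = 0].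

Lemma pullback_exists E B C (f : {linear E -> C}) (g : {linear B -> C}) :
  exists W (w1 : {linear W -> E}) (w2 : {linear W -> B}), is_pullback f g w1 w2.
Proof.
pose h : {linear prodm E B -> C} := (f \o lfst) \- (g \o lsnd).
exists (kern h), (lfst \o kinj h), (lsnd \o kinj h); split=> [w|x y e|w] /=.
- by apply/eqP; rewrite -subr_eq0; apply/eqP; exact: (kinjK w).
- have [|k kE] := @kerE _ _ _ h (pairm x y); first by rewrite /= lfstE lsndE e subrr.
  by exists k; rewrite /= kE lfstE lsndE.
- move=> e1 e2; apply: (@kinj_inj _ _ _ h); rewrite linear0.
  by apply: prodm_ext; rewrite linear0.
Qed.

Lemma is_pullbackC E B C W (f : {linear E -> C}) (g : {linear B -> C})
    (w1 : {linear W -> E}) (w2 : {linear W -> B}) :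
  is_pullback f g w1 w2 -> is_pullback g f w2 w1.
Proof.
case=> e ex inj; split=> [w|x y xy|w w0 w0']; [by rewrite e| |exact: inj].
by have [w [? ?]] := ex y x (esym xy); exists w.
Qed.

(** Base change keeps surjectivity and the kernel: [k] sends [x] to the point over [(i x, 0)]. *)
Lemma pullback_ses E B C W K (f : {linear E -> C}) (g : {linear B -> C})
    (w1 : {linear W -> E}) (w2 : {linear W -> B}) (i : {linear K -> E}) :
  is_pullback f g w1 w2 -> ses i f ->
  exists2 k : {linear K -> W}, ses k w2 & forall x, w1 (k x) = i x.
Proof.
case=> e ex inj [ii fs fi fk].
have /choice[k kE] x : exists w, w1 w = i x /\ w2 w = 0.
  by apply: ex; rewrite fi linear0.
have ext w w' : w1 w = w1 w' -> w2 w = w2 w' -> w = w'.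
  move=> e1 e2; apply/eqP; rewrite -subr_eq0; apply/eqP/inj.
    by rewrite linearB e1 subrr.
  by rewrite linearB e2 subrr.
have lin : linear k.
  move=> c x y; have [[a1 a2] [b1 b2] [c1 c2]] := And3 (kE x) (kE y) (kE (c *: x + y)).
  by apply: ext; rewrite linearP ?a1 ?a2 ?b1 ?b2 ?c1 ?c2 ?linearP ?scaler0 ?addr0.
exists (mklin lin) => [|x]; last by rewrite mklinE; have [] := kE x.
split=> [x y xy|b|a|w w0].
- move: xy; rewrite !mklinE => xy.
  by apply: ii; have [<- _] := kE x; have [<- _] := kE y; rewrite xy.
- by have [x fx] := fs (g b); have [w [_ <-]] := ex _ _ fx; exists w.
- by rewrite mklinE; have [] := kE a.
- have [|x xE] := fk (w1 w); first by rewrite e w0 linear0.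
  by exists x; have [e1 e2] := kE x; rewrite mklinE; apply: ext; rewrite ?e1 ?e2.
Qed.

(** The snake sequence [0 -> ker q -> ker (p \o q) -> ker p -> 0], with [K], [L] and [A] as the
    three kernels. *)
Lemma ses_comp_surj A B C E K L (i : {linear A -> B}) (p : {linear B -> C})
    (q : {linear E -> B}) (j : {linear K -> E}) (l : {linear L -> E}) :
  ses i p -> ses j q -> ses l (p \o q) ->
  exists (s : {linear K -> L}) (t : {linear L -> A}),
    [/\ ses s t, forall x, l (s x) = j x & forall x, i (t x) = q (l x)].
Proof.
case=> ii ps pi0 pk [ji qs qj qk] [li _ pql pqk].
have [|s sE] := @factor_inj _ _ _ _ l j li.
  by move=> k; apply: pqk; rewrite /= qj linear0.
have [|t tE] := @factor_inj _ _ _ _ i (q \o l) ii.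
  by move=> k /=; apply: pk; have := pql k.
exists s, t; split=> //; split=> [x y e|a|x|x x0].
- by apply: ji; rewrite -!sE e.
- have [e qe] := qs (i a); have [|x xE] := pqk e; first by rewrite /= qe pi0.
  by exists x; apply: ii; rewrite tE /= xE qe.
- by apply: ii; rewrite tE /= sE qj linear0.
- have [|k kE] := qk (l x); first by rewrite -[q _](tE x) x0 linear0.
  by exists k; apply: li; rewrite sE kE.
Qed.

Definition extends A B (i : {linear A -> B}) : Prop :=
  forall f : {linear A -> R^o}, exists g : {linear B -> R^o},
    forall a, g (i a) = f a.

(* [ext n M] is the vanishing of Ext^(n+1)(M, R), by dimension shifting: the
   universal quantification over presentations makes it usable, and
   [ext_syzygy] shows that one presentation is enough to establish it. *)
Fixpoint ext (n : nat) M : Prop :=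
  match n with
  | 0 => forall K E (i : {linear K -> E}) (p : {linear E -> M}),
      ses i p -> extends i
  | n'.+1 => forall K P (i : {linear K -> P}) (p : {linear P -> M}),
      projective P -> ses i p -> ext n' K
  end.

(** A sequence ending in a projective splits. The retraction [r] extends functionals when [n] is 0;
    for larger [n] it makes the kernel a summand of a projective. *)
Lemma projective_ext n P : projective P -> ext n P.
Proof.
elim: n P => [|n IH] P prP K E i p.
  move=> sip f; have [ii ps pi0 pk] := sip.
  have [s psE] := projective_split prP ps.
  have [|r rE] := @factor_inj _ _ _ _ i (idfun \- (s \o p)) ii.
    by move=> e; apply: pk; rewrite /= linearB /= psE subrr.
  by exists (f \o r) => a /=; congr (f _); apply: ii; rewrite rE /= pi0 linear0 subr0.
move=> prE [ii ps pi0 pk]; apply: IH.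
have [s psE] := projective_split prP ps.
have [|r rE] := @factor_inj _ _ _ _ i (idfun \- (s \o p)) ii.
  by move=> e; apply: pk; rewrite /= linearB /= psE subrr.
apply: (projective_retract (i := i) (r := r)) prE => x.
by apply: ii; rewrite rE /= pi0 linear0 subr0.
Qed.

(** A piece of the long exact sequence of Ext, by hand: a functional on [K] is extended to the
    pullback of [E] and [B], then corrected by a functional on [B] so that it kills [A] and descends
    to [E]. *)
Lemma ext0_quotient A B C (i : {linear A -> B}) (p : {linear B -> C}) :
  ses i p -> ext 0 B -> extends i -> ext 0 C.
Proof.
move=> sip eB exti K E j q sjq f.
have [W [w1 [w2 pb]]] := pullback_exists q p.
have [k sk kE] := pullback_ses pb sjq.
have [l [li l1 l10 l1k] lE] := pullback_ses (is_pullbackC pb) sip.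
have [g gE] := eB _ _ _ _ sk f.
have [h hE] := exti (g \o l).
have [|u uE] := @factor_surj _ _ _ _ w1 (g \- (h \o w2)) l1.
  by move=> w /l1k[a <-]; rewrite /= lE hE /= subrr.
exists u => a; rewrite -kE uE /= gE.
by have [_ _ -> _] := sk; rewrite linear0 subr0.
Qed.

(** For [n = 0], a free cover [F] of [B] presents [A] as the quotient of [ker (F -> C)] by
    [ker (F -> B)]. The inductive step passes to syzygies by the horseshoe construction. *)
Lemma ext_kernel n A B C (i : {linear A -> B}) (p : {linear B -> C}) :
  ses i p -> ext n B -> ext n.+1 C -> ext n A.
Proof.
elim: n A B C i p => [|n IH] A B C i p sip.
  move=> eB eC; pose q := frcover B.
  have sq := ses_kinj (@frcover_surj _ B).
  have [ii ps pi0 pk] := sip.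
  have pqs : surjective (p \o q).
    by move=> c; have [b <-] := ps c; have [x <-] := frcover_surj b; exists x.
  have [s [t [sst sE tE]]] := ses_comp_surj sip sq (ses_kinj pqs).
  refine (ext0_quotient sst (eC _ _ _ _ (@projective_freeg R B) (ses_kinj pqs)) _).
  move=> f; have [g gE] := eB _ _ _ _ sq f.
  by exists (g \o kinj (p \o q)) => a /=; have /= -> := sE a; rewrite gE.
move=> eB eC K P j pi prP sj.
have [ii ps pi0 pk] := sip; have [ji pis pij pik] := sj.
have prF := @projective_freeg R C.
have [g gE] := prF _ _ p (frcover C) ps.
(* The horseshoe cover of [B], built from the cover of [A] and a lift [g] of the free cover of [C];
   its kernel is an extension of the syzygy of [C] by that of [A]. *)
pose q : {linear prodm P {freeg C / R} -> B} :=
  ((i \o pi) \o lfst) \+ (g \o lsnd).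
have pq x y : p (q (pairm x y)) = frcover C y.
  by rewrite /= lfstE lsndE linearD pi0 add0r; have /= <- := gE y.
have qs : surjective q.
  move=> b; have [y yE] := frcover_surj (p b).
  have [|a aE] := pk (b - g y).
    by rewrite linearB /= -[p (g y)](gE y) yE subrr.
  by have [x xE] := pis a; exists (pairm x y); rewrite /= lfstE lsndE xE aE subrK.
have [|a aE] := @factor_inj _ _ _ _ (kinj q) (linl \o j) (@kinj_inj _ _ _ q).
  by move=> k; apply: kerE; rewrite /= linlE lfstE lsndE pij !linear0 addr0.
have [|b bE] := @factor_inj _ _ _ _ (kinj (frcover C)) (lsnd \o kinj q)
  (@kinj_inj _ _ _ _).
  move=> k; apply: kerE; have := kinjK k; rewrite [kinj q k]pairm_eta => k0.
  by rewrite -(pq (lfst (kinj q k))) k0 linear0.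
apply: (IH _ _ _ a b).
- split=> [x y e|y|x|x x0].
  + apply: ji; have := congr1 lfst (aE x).
    by rewrite e aE /= !linlE !lfstE.
  + have [u uE] : exists u, i u = - g (kinj _ y).
      by apply: pk; rewrite linearN -[p _](gE (kinj _ y)) [frcover C _]kinjK oppr0.
    have [x xE] := pis u.
    have [|k kE] := @kerE _ _ _ q (pairm x (kinj _ y)).
      by rewrite /= lfstE lsndE xE uE addNr.
    by exists k; apply: kinj_inj; rewrite bE /= kE lsndE.
  + by apply: kinj_inj; rewrite bE /= aE /= linlE lsndE linear0.
  + have v0 : lsnd (kinj q x) = 0 by have /= <- := bE x; rewrite x0 linear0.
    have [|y yE] := pik (lfst (kinj q x)).
      apply: ii; have := kinjK x; rewrite /= v0 linear0 addr0 => ->.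
      by rewrite linear0.
    exists y; apply: kinj_inj; rewrite aE /= yE.
    by apply: prodm_ext; rewrite linlE ?lfstE ?lsndE.
- exact: eB (projective_prod prP prF) (ses_kinj qs).
- exact: eC prF (ses_kinj (@frcover_surj _ C)).
Qed.

(** For [n = 0] a functional on [K] is extended twice: to [ker (p \o q)] by the hypothesis on [A],
    then to [E] by that on [C]. For larger [n], [K] is the kernel of a map from [ker (p \o q)] onto
    [A], and [ext_kernel] applies. *)
Lemma ext_extension n A B C (i : {linear A -> B}) (p : {linear B -> C}) :
  ses i p -> ext n A -> ext n C -> ext n B.
Proof.
elim: n A B C i p => [|n IH] A B C i p sip eA eC K E j q sjq.
  move=> f; have [ii ps pi0 pk] := sip; have [ji qs qj qk] := sjq.
  have pqs : surjective (p \o q).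
    by move=> c; have [b <-] := ps c; have [x <-] := qs b; exists x.
  have [s [t [sst sE tE]]] := ses_comp_surj sip sjq (ses_kinj pqs).
  have [g gE] := eA _ _ _ _ sst f.
  have [h hE] := eC _ _ _ _ (ses_kinj pqs) g.
  by exists h => a; rewrite -sE hE gE.
move=> sjq'; have [ii ps pi0 pk] := sip; have [ji qs qj qk] := sjq'.
have pqs : surjective (p \o q).
  by move=> c; have [b <-] := ps c; have [x <-] := qs b; exists x.
have [s [t [sst sE tE]]] := ses_comp_surj sip sjq' (ses_kinj pqs).
apply: ext_kernel sst _ eA.
by apply: eC (ses_kinj pqs).
Qed.

(** The pullback [W] of [P] and [B] over [C] is an extension of [P] by [A] and of [B] by [K]; the
    first gives vanishing for [W], the second passes it to [K]. *)
Lemma ext_quotient n A B C (i : {linear A -> B}) (p : {linear B -> C}) :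
  ses i p -> ext n A -> ext n.+1 B -> ext n.+1 C.
Proof.
move=> sip eA eB K P j q prP sjq.
have [W [w1 [w2 pb]]] := pullback_exists q p.
have [k sk kE] := pullback_ses pb sjq.
have [l sl lE] := pullback_ses (is_pullbackC pb) sip.
apply: ext_kernel sk _ eB.
by apply: ext_extension sl eA _; exact: projective_ext.
Qed.

Lemma ext_syzygy n K P M (i : {linear K -> P}) (p : {linear P -> M}) :
  projective P -> ses i p -> ext n K -> ext n.+1 M.
Proof. by move=> prP sip eK; apply: ext_quotient sip eK _; exact: projective_ext. Qed.

Lemma ext_iso n A B (f : {linear A -> B}) :
  injective f -> surjective f -> ext n A -> ext n B.
Proof.
move=> fi fs eA.
have z0 : is_zero (mod0 R) by move=> x; apply/rowP; case.
apply: (@ext_extension _ A B (mod0 R) f \0) => //; last first.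
  exact/projective_ext/projective_is_zero.
by split=> //= v; exists 0; rewrite (z0 v).
Qed.

(** * Comparison of [ext] with Ext vanishing computed from resolutions *)

Section Resolutions.

Definition complex_tail (C : complex R) : complex R :=
  @Complex R (fun n => C n.+1) (fun n => cdiff C n.+1) (fun n => @cdiffK R C n.+1).

(** Dimension shift: cutting off degree 0 leaves a resolution of the first syzygy. *)
Lemma tail_augmentation (C : complex R) M (e : augmentation C M) :
  exact_complex (augmented e) ->
  exists e' : augmentation (complex_tail C) (kern e),
    exact_complex (augmented e') /\ forall x, kinj e (e' x) = cdiff C 0 x.
Proof.
case=> es ex.
have [|d dE] := @factor_inj _ _ _ _ (kinj e) (cdiff C 0) (@kinj_inj _ _ _ e).
  by move=> x; apply: kerE; exact: augK.
have dK (x : complex_tail C 1) : d (cdiff (complex_tail C) 0 x) = 0.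
  by apply: kinj_inj; rewrite dE /= cdiffK linear0.
exists (@Augmentation R (complex_tail C) (kern e) d dK); split=> //; split=> [k|].
  have [x xE] := ex 0 (kinj e k) (kinjK k).
  by exists x; apply: kinj_inj; rewrite dE.
case=> [y y0|n y y0]; last exact: (ex n.+2 y y0).
apply: (ex 1 y); rewrite -[LHS]dE.
by rewrite /= in y0; rewrite y0 linear0.
Qed.

(** The converse of truncation. Here [augmented e'] serves as a complex, with [P] in degree 0 and
    [C] moved up by one, and [e''] supplies the map onto [M]. *)
Lemma splice (C : complex R) K P M (e : augmentation C K)
    (i : {linear K -> P}) (p : {linear P -> M}) :
  ses i p -> exact_complex (augmented e) ->
  exists (e' : augmentation C P) (e'' : augmentation (augmented e') M),
    exact_complex (augmented e'').
Proof.
move=> [ii ps pi0 pk] [es ex].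
have eK x : (i \o e) (cdiff C 0 x) = 0 by rewrite /= augK linear0.
pose e' := @Augmentation R C P (i \o e) eK.
have e'K (x : augmented e' 1) : p (cdiff (augmented e') 0 x) = 0 by exact: pi0.
exists e', (@Augmentation R (augmented e') M p e'K); split=> [|[|[|n]]] //.
- by move=> y /pk[k <-]; have [x <-] := es k; exists x.
- move=> y /= y0; apply: (ex 0); apply: ii.
  by rewrite linear0.
- exact: (ex n.+1).
Qed.

Fixpoint syz M n : lmodType R :=
  if n is k.+1 then kern (frcover (syz M k)) else M.

Definition free_diff M n :
    {linear {freeg (syz M n.+1) / R} -> {freeg (syz M n) / R}} :=
  kinj (frcover (syz M n)) \o frcover (syz M n.+1).

Fact free_diffK M n x : free_diff M n (free_diff M n.+1 x) = 0.
Proof. by rewrite /free_diff /= [frlift _ (kinj _ _)]kinjK linear0. Qed.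

Definition free_complex M : complex R := Complex (@free_diffK M).

Fact free_augK M x : frcover M (cdiff (free_complex M) 0 x) = 0.
Proof. exact: kinjK. Qed.

Definition free_aug M : augmentation (free_complex M) M :=
  Augmentation (@free_augK M).

Lemma free_resolution M : projective_resolution (free_aug M).
Proof.
split=> [n|]; first exact: projective_freeg.
have ex n (y : {freeg (syz M n) / R}) :
    frcover (syz M n) y = 0 -> exists x, free_diff M n x = y.
  by move=> /kerE[k <-]; have [x <-] := frcover_surj k; exists x.
split=> [|[|n]]; [exact: frcover_surj | exact: ex |].
move=> y y0; apply: (ex n.+1 y); apply: kinj_inj.
by rewrite linear0; exact: y0.
Qed.

(** A functional on the first syzygy is a cocycle on [C 1], which settles [n = 0]; higher degrees
    shift along the tail of [C]. *)
Lemma ext_ExtS n M : ExtS_eq0 n M R^o -> ext n M.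
Proof.
elim: n M => [|n IH] M [C [e [[prC exC] extC]]].
  have [e' [exC' e'E]] := tail_augmentation exC.
  have se := ses_kinj exC.1.
  refine (ext0_quotient se (@projective_ext 0 _ (prC 0)) _).
  move=> f; have [x|g gE] := extC (f \o e').
    have /= -> := augK e' x; exact: linear0.
  exists g => k; have [x <-] := exC'.1 k.
  by rewrite e'E; exact/esym/gE.
have [e' [exC' e'E]] := tail_augmentation exC.
apply: ext_syzygy (ses_kinj exC.1) _; first exact: prC.
apply: IH; exists (complex_tail C), e'; split.
  by split=> // k; exact: prC.
exact: extC.
Qed.

(** The witness is the free resolution for [n = 0], and otherwise the witness for the syzygy spliced
    onto a free cover. *)
Lemma ExtS_ext n M : ext n M -> ExtS_eq0 n M R^o.
Proof.
elim: n M => [|n IH] M eM.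
  have [prF exF] := free_resolution M.
  have [e' [exF' e'E]] := tail_augmentation exF.
  exists (free_complex M), (free_aug M); split; first by split.
  move=> f f0.
  have [|h hE] := @factor_surj _ _ _ _ e' f exF'.1.
    move=> x x0; have [y <-] := exF'.2 0 x x0; exact: f0.
  have [g gE] := eM _ _ _ _ (ses_kinj exF.1) h.
  by exists g => x; rewrite -hE -gE; congr (g _); exact: e'E.
have sM := ses_kinj (@frcover_surj _ M).
have [C [e [[prC exC] extC]]] := IH _ (eM _ _ _ _ (@projective_freeg R _) sM).
have [e' [e'' ex'']] := splice sM exC.
exists (augmented e'), e''; split; last exact: extC.
by split=> // -[|k]; [exact: projective_freeg | exact: prC].
Qed.

End Resolutions.
End Ext.

(** * Finitely generated modules and Nakayama's lemma *)

Section Noetherian.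
Variable R : comNzRingType.
Implicit Types A B C E K M N V W : lmodType R.

Definition fg V : Prop :=
  exists n (p : {linear 'rV[R]_n -> V}), surjective p.

Lemma fgP V : finitely_generated V <-> fg V.
Proof.
split=> [[n [u span_u]]|[n [p ps]]].
  exists n, (rvlift u) => v.
  have /spanP[k [a [w [uw ->]]]] := span_u v.
  have /choice[y yE] i : exists y, rvlift u y = w i.
    have [j _ <-] := uw i; by exists (delta_mx 0 j); rewrite rvlift_delta.
  exists (\sum_i a i *: y i); rewrite linear_sum.
  by apply: eq_bigr => i _; rewrite linearZ yE.
exists n, (fun i => p (delta_mx 0 i)) => v; have [y <-] := ps v.
apply/spanP; exists n, (fun i => y 0 i), (fun i => p (delta_mx 0 i)).
by split=> [i|]; [exists i | exact: rvliftE].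
Qed.

Lemma fg_surj V W (f : {linear V -> W}) : surjective f -> fg V -> fg W.
Proof.
move=> fs [n [p ps]]; exists n, (f \o p) => w.
by have [v <-] := fs w; have [y <-] := ps v; exists y.
Qed.

Fact rvcat_linear n m V (p : {linear 'rV[R]_n -> V}) (q : {linear 'rV[R]_m -> V}) :
  linear (fun y : 'rV[R]_(n + m) => p (lsubmx y) + q (rsubmx y)).
Proof.
by move=> c y z; rewrite !linearP scalerDr addrACA.
Qed.

Definition rvcat n m V (p : {linear 'rV[R]_n -> V})
    (q : {linear 'rV[R]_m -> V}) : {linear 'rV[R]_(n + m) -> V} :=
  mklin (rvcat_linear p q).

Lemma rvcatE n m V (p : {linear 'rV[R]_n -> V}) (q : {linear 'rV[R]_m -> V}) y z :
  rvcat p q (row_mx y z) = p y + q z.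
Proof. by rewrite /rvcat mklinE row_mxKl row_mxKr. Qed.

Lemma fg_extension A B C (i : {linear A -> B}) (p : {linear B -> C}) :
  ses i p -> fg A -> fg C -> fg B.
Proof.
case=> ii ps pi0 pk [n [f fs]] [m [g gs]].
have [h hE] := projective_rV (M := B) (p := p) g ps.
exists (n + m)%N, (rvcat (i \o f) h) => b.
have [z zE] := gs (p b); have [|a aE] := pk (b - h z).
  by rewrite linearB /= -[p (h z)](hE z) zE subrr.
by have [y yE] := fs a; exists (row_mx y z); rewrite rvcatE /= yE aE subrK.
Qed.

Lemma fg_regular : fg (R^o : lmodType R).
Proof.
have lin : linear (fun y : 'rV[R]_1 => y 0 0 : R^o) by move=> c x y; rewrite !mxE.
by exists 1%N, (mklin lin) => r; exists (const_mx r); rewrite mklinE mxE.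
Qed.

(** All submodules of [V] are finitely generated. They are given as images of maps and the
    generators are chosen in the source [A], which avoids submodule types. *)
Definition noeth V : Prop :=
  forall A (g : {linear A -> V}), exists n (p : {linear 'rV[R]_n -> A}),
    forall a, exists y, g (p y) = g a.

(** This is noetherianity of [N^n]: generators for the image of the first map are joined with
    elements of its kernel that generate for the remaining maps. *)
Lemma noeth_family n N A (g : 'I_n -> {linear A -> N}) : noeth N ->
  exists m (p : {linear 'rV[R]_m -> A}),
    forall a, exists y, forall i, g i (p y) = g i a.
Proof.
move=> nN; elim: n A g => [|n IH] A g.
  by exists 0%N, \0 => a; exists 0; case.
have [m1 [p1 p1E]] := nN _ (g ord0).
have [m2 [p2 p2E]] := IH _ (fun i => g (fintype.lift ord0 i) \o kinj (g ord0)).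
exists (m1 + m2)%N, (rvcat p1 (kinj (g ord0) \o p2)) => a.
have [y yE] := p1E a.
have [|k kE] := @kerE _ _ _ (g ord0) (a - p1 y).
  by rewrite linearB /= yE subrr.
have [z zE] := p2E k; exists (row_mx y z) => i; rewrite rvcatE linearD /=.
case: (unliftP ord0 i) => [j|] ->; last by rewrite kinjK addr0 yE.
by have /= -> := zE j; rewrite kE linearB addrC subrK.
Qed.

Lemma fg_noeth V : noeth R^o -> fg V -> noeth V.
Proof.
move=> nR [n [q qs]] A g.
have [W [w1 [w2 [we wex _]]]] := pullback_exists g q.
have cl (i : 'I_n) : linear ((fun y : 'rV[R]_n => y 0 i : R^o) \o w2).
  by move=> c x y; rewrite /= linearP !mxE.
have [m [p pE]] := noeth_family (fun i => mklin (cl i)) nR.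
exists m, (w1 \o p) => a; have [y yE] := qs (g a).
have [w [w1E w2E]] := wex a y (esym yE).
have [z zE] := pE w; exists z; rewrite /= we -w1E we.
congr (q _); apply/rowP => i.
by have := zE i; rewrite !mklinE.
Qed.

Lemma noetherian_noeth : noetherian R -> noeth R^o.
Proof.
move=> nR A g; pose I : {pred R^o} := fun y => `[< exists a, g a = y >].
have clI : submod_closed I.
  split=> [|c _ _ /asboolP[a <-] /asboolP[b <-]]; apply/asboolP.
    by exists 0; rewrite linear0.
  by exists (c *: a + b); rewrite linearP.
have [n [u uE]] := nR I clI.
have /choice[a aE] i : exists a, g a = u i.
  by apply/asboolP; rewrite -[asbool _]/(u i \in I) uE; apply: mem_span; exists i.
exists n, (rvlift a) => b.
have : g b \in I by apply/asboolP; exists b.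
rewrite uE => /spanP[k [c [w [wu ->]]]].
have /choice[y yE] i : exists y, g (rvlift a y) = w i.
  have [j _ <-] := wu i; by exists (delta_mx 0 j); rewrite rvlift_delta.
exists (\sum_i c i *: y i); rewrite !linear_sum.
by apply: eq_bigr => i _; rewrite -yE !linearZ.
Qed.

Hypothesis nR : noetherian R.

Lemma fg_sub V W (f : {linear V -> W}) : injective f -> fg W -> fg V.
Proof.
move=> fi fgW; have [n [p pE]] := fg_noeth (noetherian_noeth nR) fgW f.
by exists n, p => v; have [y /fi yE] := pE v; exists y.
Qed.

(** Evaluation at generators of [V] embeds [Hom(V, W)] in a finite power of [W]. *)
Lemma fg_hom V W : fg V -> fg W -> fg ({linear V -> W} : lmodType R).
Proof.
move=> [n [p ps]] fgW.
have el (i : 'I_n) :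
  linear (fun f : ({linear V -> W} : lmodType R) =>
    (f : {linear V -> W}) (p (delta_mx 0 i))) by [].
have nW := fg_noeth (noetherian_noeth nR) fgW.
have [m [q qE]] := noeth_family (fun i => mklin (el i)) nW.
exists m, q => f; have [y yE] := qE f; exists y; apply: lin_ext => v.
have [z <-] := ps v; rewrite [p z]rvliftE !linear_sum.
apply: eq_bigr => i _; rewrite !linearZ /=; congr (_ *: _).
by have := yE i; rewrite !mklinE.
Qed.

End Noetherian.

Section Nakayama.
Variable R : comNzRingType.

Definition in_jacobson (a : R) : Prop :=
  forall r, exists c, c * (1 - a * r) = 1.

(** Were [u = 1 - a r] not a unit, Zorn's lemma would put it in a maximal ideal, necessarily [m];
    with [a] in [m] this forces 1 into [m]. *)
Lemma local_jacobson (m : {pred R^o}) a :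
  local_ring m -> a \in m -> in_jacobson a.
Proof.
case=> -[mcl m1 mmax] muniq am r; apply: contrapT => nu.
pose u : R^o := 1 - a * r.
pose pr (X : set R^o) : {pred R^o} := fun y => `[< X y >].
pose Q : set (set R^o) :=
  fun X => X = set0 \/ [/\ submod_closed (pr X), X u & ~ X 1].
have [F FQ tot|I [QI maxI]] := @Zorn_bigcup R^o Q.
  have [[X FX [y Xy]]|noX] := EM (exists2 X, F X & exists y, X y); last first.
    left; apply/seteqP; split=> // y [X FX Xy].
    by case: noX; exists X => //; exists y.
  have FP Z z : F Z -> Z z -> [/\ submod_closed (pr Z), Z u & ~ Z 1].
    by move=> /FQ[->|].
  right; split.
  - split=> [|c z w].
      have [[cl _] _ _] := FP _ _ FX Xy.
      by apply/asboolP; exists X => //; apply/asboolP.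
    move=> /asboolP[Z FZ Zz] /asboolP[W FW Ww]; apply/asboolP.
    have [ZW|WZ] := tot _ _ FZ FW.
      exists W => //; have [[_ cl] _ _] := FP _ _ FW Ww.
      by apply/asboolP; apply: cl; apply/asboolP => //; exact: ZW.
    exists Z => //; have [[_ cl] _ _] := FP _ _ FZ Zz.
    by apply/asboolP; apply: cl; apply/asboolP => //; exact: WZ.
  - by exists X => //; have [] := FP _ _ FX Xy.
  - by move=> [Z FZ Z1]; have [_ _] := FP _ _ FZ Z1.
have Iu : [/\ submod_closed (pr I), I u & ~ I 1].
  case: QI => // I0; case: (maxI (fun y : R^o => exists s : R, y = s * u)).
    rewrite I0; split=> // /(_ u); apply; exists 1; by rewrite mul1r.
  right; split=> [||[s s1]].
  - split=> [|c _ _ /asboolP[s ->] /asboolP[t ->]]; apply/asboolP.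
      by exists 0; rewrite mul0r.
    by exists (c * s + t); rewrite mulrDl -mulrA.
  - by exists 1; rewrite mul1r.
  - by apply: nu; exists s; rewrite -s1.
have [Icl uI I1] := Iu.
have maxprI : maximal_ideal (pr I).
  split=> // [|J Jcl IJ J1]; first by apply/asboolP.
  have JI : ~ (exists2 y, y \in J & ~ I y).
    move=> [y yJ nIy]; apply: (maxI (fun y : R^o => y \in J)).
      split=> [z Iz|/(_ y yJ)//]; apply: IJ; exact/asboolP.
    right; split=> [||/(negP J1)] //; last by apply: IJ; exact/asboolP.
    split=> [|c z w /asboolP zJ /asboolP wJ]; apply/asboolP; first by case: Jcl.
    by case: Jcl => _; apply.
  move=> y; apply/idP/idP => [yJ|/IJ//].
  by apply/asboolP; apply: contrapT => nIy; apply: JI; exists y.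
have um : (u : R^o) \in m by rewrite -(muniq _ maxprI); apply/asboolP.
move/negP: m1; apply; case: mcl => m0 mcl.
have -> : (1 : R^o) = r *: (a : R^o) + u by rewrite addrC /u [_ *: _]mulrC subrK.
exact: mcl.
Qed.

(** Nakayama for [E/S], with the submodule [S] kept as a predicate to avoid the quotient. Modulo
    [S], the first generator is [a y] with [y] a combination of all generators; inverting [1 - a c],
    where [c] is its own coefficient in [y], eliminates it. *)
Lemma nakayama n (E : lmodType R) (a : R) (u : 'I_n -> E) (S : E -> Prop) :
  in_jacobson a ->
  (forall c x y, S x -> S y -> S (c *: x + y)) -> S 0 ->
  (forall x, exists c : 'I_n -> R, S (x - \sum_i c i *: u i)) ->
  (forall x, exists y, S (x - a *: y)) -> forall x, S x.
Proof.
move=> ja Sl S0 + SA; elim: n u => [|n IH] u Su.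
  by move=> x; have [c] := Su x; rewrite big_ord0 subr0.
have SZ c x : S x -> S (c *: x) by move=> Sx; rewrite -[_ *: _]addr0; exact: Sl.
have SD x y : S x -> S y -> S (x + y) by move=> Sx Sy; rewrite -[x]scale1r; exact: Sl.
apply: (IH (u \o fintype.lift ord0)).
have [d Sd] : exists d : 'I_n -> R, S (u ord0 - \sum_i d i *: u (fintype.lift ord0 i)).
  have [y Sy] := SA (u ord0); have [c] := Su y; rewrite big_ord_recl => Sc.
  have [r rE] := ja (c ord0).
  exists (fun i => r * a * c (fintype.lift ord0 i)).
  have := SZ r _ (SD _ _ Sy (SZ a _ Sc)).
  set T := \sum_i _; congr S.
  have -> : u ord0 - a *: y + a *: (y - (c ord0 *: u ord0 + T))
      = (1 - a * c ord0) *: u ord0 - a *: T.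
    by rewrite scalerBr addrA subrK scalerDr scalerA opprD addrA scalerBl scale1r.
  rewrite scalerBr scalerA rE scale1r scalerA scaler_sumr; congr (_ - _).
  by apply: eq_bigr => i _; rewrite scalerA.
move=> x; have [c] := Su x; rewrite big_ord_recl => Sc.
exists (fun i => c ord0 * d i + c (fintype.lift ord0 i)).
have := SD _ _ Sc (SZ (c ord0) _ Sd); congr S.
have -> : \sum_i (c ord0 * d i + c (fintype.lift ord0 i)) *: (u \o fintype.lift ord0) i
    = c ord0 *: (\sum_i d i *: u (fintype.lift ord0 i))
      + \sum_i c (fintype.lift ord0 i) *: u (fintype.lift ord0 i).
  rewrite scaler_sumr -big_split; apply: eq_bigr => i _ /=.
  by rewrite scalerDl scalerA.
by rewrite scalerBr !opprD !addrA (addrAC _ _ (c ord0 *: u ord0)) subrK addrAC.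
Qed.

End Nakayama.

(** * Totally reflexive modules *)

Section Duality.
Variable R : comNzRingType.
Implicit Types A B C E K M N V W : lmodType R.

Definition toLin V W (f : ({linear V -> W} : lmodType R)) : {linear V -> W} := f.

Lemma dual_ext V (f g : dualmod V) :
  (forall v, evalat v f = evalat v g) -> f = g.
Proof. exact: lin_ext. Qed.

Fact dmap_linear V W (f : {linear V -> W}) :
  linear (fun g : dualmod W => (g : {linear W -> R^o}) \o f : dualmod V).
Proof. by move=> c g h; apply: lin_ext. Qed.

Definition dmap V W (f : {linear V -> W}) : {linear dualmod W -> dualmod V} :=
  mklin (dmap_linear f).

Lemma dmapE V W (f : {linear V -> W}) g v :
  evalat v (dmap f g) = evalat (f v) g.
Proof. by rewrite /dmap mklinE. Qed.

Lemma bidualityE V (v : V) f : evalat f (biduality v) = evalat v f.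
Proof. by []. Qed.

Lemma dual_ses A B C (i : {linear A -> B}) (p : {linear B -> C}) :
  ses i p -> extends i -> ses (dmap p) (dmap i).
Proof.
case=> ii ps pi0 pk exi; split=> [f g e|f|f|f f0].
- by apply: dual_ext => c; have [b <-] := ps c; rewrite -!dmapE e.
- have [g gE] := exi f; exists g; apply: dual_ext => a.
  by rewrite dmapE; exact: gE.
- by apply: dual_ext => a; rewrite !dmapE pi0; exact: linear0.
- have [|g gE] := @factor_surj _ _ _ _ p (f : {linear _ -> _}) ps.
    by move=> u /pk[a <-]; rewrite -[LHS]/(evalat (i a) f) -dmapE f0.
  by exists g; apply: dual_ext => b; rewrite dmapE; exact: gE.
Qed.

Lemma dmap_inj V W (f : {linear V -> W}) : surjective f -> injective (dmap f).
Proof.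
by move=> fs g h e; apply: dual_ext => w; have [v <-] := fs w; rewrite -!dmapE e.
Qed.

Lemma dmap_surj V W (f : {linear V -> W}) :
  injective f -> surjective f -> surjective (dmap f).
Proof.
move=> fi fs g; have [|h hE] := @factor_inj _ _ _ _ f idfun fi.
  by move=> w; have [v <-] := fs w; exists v.
exists ((g : {linear V -> R^o}) \o h : {linear W -> R^o}).
apply: dual_ext => v; rewrite dmapE.
by rewrite /evalat /=; congr (_ _); apply: fi; rewrite hE.
Qed.

Definition reflexive_module V : Prop :=
  injective (@biduality R V) /\ surjective (@biduality R V).

Definition TR V : Prop :=
  [/\ fg V, reflexive_module V, forall n, ext n V & forall n, ext n (dualmod V)].

Lemma TRP V : totally_reflexive V <-> TR V.
Proof.
split=> [[/fgP fgV bV eV edV]|[/fgP fgV [bi bs] eV edV]]; split=> // [|n|n].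
- split; first exact: bij_inj.
  by case: bV => g gK Kg w; exists (g w).
- exact: ext_ExtS.
- exact: ext_ExtS.
- have /choice[g gE] := bs; exists g => // v; exact: bi.
- exact: ExtS_ext.
- exact: ExtS_ext.
Qed.

Lemma reflexive_iso V W (f : {linear V -> W}) :
  injective f -> surjective f -> reflexive_module V -> reflexive_module W.
Proof.
move=> fi fs [bi bs].
have bf v : biduality (f v) = dmap (dmap f) (biduality v).
  by apply: dual_ext => g; rewrite dmapE !bidualityE dmapE.
have di : injective (dmap (dmap f)) by apply: dmap_inj; exact: dmap_surj.
have ds : surjective (dmap (dmap f)).
  by apply: dmap_surj; [exact: dmap_inj | exact: dmap_surj].
split=> [w w'|g].
  have [v <-] := fs w; have [v' <-] := fs w'; rewrite !bf => /di/bi -> //.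
by have [h <-] := ds g; have [v <-] := bs h; exists (f v); rewrite bf.
Qed.

Lemma TR_iso V W (f : {linear V -> W}) :
  injective f -> surjective f -> TR V -> TR W.
Proof.
move=> fi fs [fgV rV eV edV]; split=> [||n|n].
- exact: fg_surj fs fgV.
- exact: reflexive_iso fi fs rV.
- exact: ext_iso fi fs (eV n).
- have [|g gE] := @factor_inj _ _ _ _ f idfun fi.
    by move=> w; have [v <-] := fs w; exists v.
  have gK v : g (f v) = v by apply: fi; rewrite gE.
  have gi : injective g by move=> w w' e; rewrite -[w]gE -[w']gE e.
  have gs : surjective g by move=> v; exists (f v).
  by apply: (@ext_iso _ _ _ _ (dmap g)) (edV n); [exact: dmap_inj | exact: dmap_surj].
Qed.

(** Vanishing of the first Ext of [C] keeps the dual sequence exact, and reflexivity of [B] follows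
    by a five lemma chase. *)
Lemma TR_extension A B C (i : {linear A -> B}) (p : {linear B -> C}) :
  ses i p -> TR A -> TR C -> TR B.
Proof.
move=> sip [fgA [biA bsA] eA edA] [fgC [biC bsC] eC edC].
have [ii ps pi0 pk] := sip.
have exi : extends i by refine (eC 0%N _ _ _ _ sip).
have dsip := dual_ses sip exi; have [_ is_ _ _] := dsip.
split=> [||n|n].
- exact: fg_extension sip fgA fgC.
- split=> [|phi].
    apply: ker0_inj => b b0.
    have [|a aE] := pk b.
      apply: biC; rewrite linear0; apply: dual_ext => h.
      by rewrite bidualityE -dmapE -bidualityE b0.
    suff a0 : a = 0 by rewrite -aE a0 linear0.
    apply: biA; rewrite linear0; apply: dual_ext => h.
    have [g <-] := is_ h; rewrite bidualityE dmapE aE -bidualityE b0.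
    by [].
  (* Subtracting from [phi] the evaluation at a lift [b] of [c] leaves a functional that kills the
     image of the dual of [C]. It descends to [psi] on the dual of [A], and reflexivity of [A]
     supplies [a]. *)
  have [c cE] := bsC (dmap (dmap p) phi).
  have [b bE] := ps c.
  have [|psi psiE] := @factor_surj _ _ _ _ (dmap i)
      (toLin phi \- toLin (biduality b)) is_.
    move=> g g0; have [_ _ _ /(_ g g0)[h <-]] := dsip.
    change (evalat (dmap p h) phi - evalat b (dmap p h) = 0).
    by rewrite -dmapE -cE bidualityE dmapE bE subrr.
  have [a aE] := bsA psi; exists (i a + b); apply: dual_ext => g.
  have E : evalat (dmap i g) psi = evalat g phi - evalat b g by exact: psiE.
  rewrite bidualityE -[evalat (i a + b) g]/(toLin g (i a + b)) linearD.
  change (evalat (i a) g + evalat b g = evalat g phi).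
  by rewrite -dmapE -bidualityE aE E subrK.
- exact: ext_extension sip (eA n) (eC n).
- exact: ext_extension dsip (edC n) (edA n).
Qed.

Lemma ext_zero n V : is_zero V -> ext n V.
Proof. by move=> V0; apply/projective_ext/projective_is_zero. Qed.

Lemma dual_is_zero V : is_zero V -> is_zero (dualmod V).
Proof.
move=> V0 f; apply: dual_ext => v; rewrite (V0 v).
by rewrite /evalat !linear0.
Qed.

Lemma TR_zero V : is_zero V -> TR V.
Proof.
move=> V0; have d0 := dual_is_zero V0; split=> [||n|n].
- by exists 0%N, \0 => v; exists 0; rewrite (V0 v).
- split=> [u v _|v]; first by rewrite (V0 u) (V0 v).
  by exists 0; rewrite linear0 (dual_is_zero d0 v).
- exact: ext_zero.
- exact: ext_zero.
Qed.

Lemma projective_regular : projective (R^o : lmodType R).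
Proof.
move=> M N p f sp; have [v vE] := sp (f 1).
have lin : linear (fun r : R^o => r *: v) by move=> c r s; rewrite scalerDl scalerA.
exists (mklin lin) => r; rewrite /= mklinE linearZ /= vE -linearZ /=.
by congr (f _); rewrite [RHS]mulr1.
Qed.

Lemma dual_regular : exists f : {linear R^o -> dualmod (R^o : lmodType R)},
  injective f /\ surjective f.
Proof.
have lin : linear (fun r : R^o => (r \*: (idfun : {linear R^o -> R^o}) : dualmod R^o)).
  by move=> c r s; apply: dual_ext => x; rewrite /evalat /= [LHS]mulrDl -mulrA.
exists (mklin lin); split=> [r s|g].
  rewrite !mklinE => /(congr1 (evalat 1)).
  by rewrite /evalat /= -[_ *: _]/(_ * _) -[s *: _]/(_ * _) !mulr1.
exists (evalat 1 g); rewrite mklinE; apply: dual_ext => x.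
rewrite /evalat /= -[_ *: x]/(_ * x) mulrC -[_ * _]/(x *: _) -linearZ /=.
by congr (_ _); exact: mulr1.
Qed.

Lemma TR_regular : TR R^o.
Proof.
have [f [fi fs]] := dual_regular; split=> [||n|n].
- exact: fg_regular.
- split=> [r s|phi].
    move=> /(congr1 (evalat (idfun : {linear R^o -> R^o}))).
    by rewrite !bidualityE.
  exists (evalat (idfun : {linear R^o -> R^o}) phi); apply: dual_ext => g.
  rewrite bidualityE.
  have gE : g = (evalat 1 g : R) *: ((idfun : {linear R^o -> R^o}) : dualmod R^o).
    apply: dual_ext => x; rewrite -[RHS]/(_ * x) mulrC -[RHS]/(x *: _).
    by rewrite /evalat -linearZ; congr (_ _); rewrite -[RHS]/(x * 1) mulr1.
  rewrite [in RHS]gE /evalat [RHS]linearZ /=.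
  rewrite -[RHS]/(_ * _) mulrC -[RHS]/(_ *: _) -linearZ.
  by congr (_ _); rewrite -[RHS]/(_ * 1) mulr1.
- exact/projective_ext/projective_regular.
- exact/(ext_iso fi fs)/projective_ext/projective_regular.
Qed.

Lemma TR_prod V W : TR V -> TR W -> TR (prodm V W).
Proof. exact: TR_extension (ses_prod _ _). Qed.

Lemma TR_rV n : TR 'rV[R]_n.
Proof.
elim: n => [|n IH]; first by apply: TR_zero => x; apply/rowP; case.
have lin : linear (fun x : prodm 'rV[R]_n R^o =>
    row_mx (lsnd x)%:M (lfst x) : 'rV[R]_n.+1).
  move=> c x y; rewrite !linearP /=; apply/rowP => i; rewrite !mxE.
  by case: splitP => j _; rewrite !mxE // mulrnDl mulrnAr.
apply: (@TR_iso _ _ (mklin lin)) (TR_prod IH TR_regular) => [x y|y].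
  rewrite !(mklinE lin) => /(@eq_row_mx _ 1 1 n)[/rowP/(_ 0) e1 e2].
  by apply: prodm_ext => //; move: e1; rewrite !mxE eqxx !mulr1n.
exists (pairm (rsubmx (y : 'rV_(1 + n))) (y 0 0 : R^o)); rewrite (mklinE lin) lfstE lsndE.
apply/rowP => i; rewrite !mxE; case: splitP => j ij; rewrite !mxE.
  by rewrite (ord1 j) eqxx mulr1n; congr (y _ _); apply/val_inj; rewrite /= ij ord1.
by congr (y _ _); exact/val_inj.
Qed.

(** Biduality carries the Ext vanishing of [V] to its bidual, and [phi] in the triple dual is
    evaluation at its restriction to [V]. *)
Lemma TR_dual (nR : noetherian R) V : TR V -> TR (dualmod V).
Proof.
move=> [fgV [bi bs] eV edV]; split=> // [||n].
- by apply: fg_hom => //; exact: fg_regular.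
- split=> [|phi].
    apply: ker0_inj => f f0; apply: dual_ext => v.
    by rewrite -bidualityE -bidualityE f0.
  have lin : linear (fun v => evalat (biduality v) phi).
    by move=> c u v; rewrite [biduality _]linearP; exact: linearP.
  exists (mklin lin : dualmod V); apply: dual_ext => g.
  have [v <-] := bs g; rewrite !bidualityE.
  by rewrite /evalat mklinE.
- exact: ext_iso bi bs (eV n).
Qed.

(** The dual of [A] is the quotient of the dual of [B] by that of [C]. Its first Ext vanishes by
    [exp]: a functional on the dual of [C] is evaluation at an element of [C], and that element
    lifts to [B]. *)
Lemma TR_kernel (nR : noetherian R) A B C (i : {linear A -> B})
    (p : {linear B -> C}) : ses i p -> TR B -> TR C -> TR A.
Proof.
move=> sip [fgB [biB bsB] eB edB] [fgC [biC bsC] eC edC].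
have [ii ps pi0 pk] := sip.
have exi : extends i by refine (eC 0%N _ _ _ _ sip).
have dsip := dual_ses sip exi; have [_ is_ _ _] := dsip.
have exp : extends (dmap p).
  move=> f; have [c cE] := bsC f; have [b bE] := ps c.
  exists (biduality b) => g; rewrite -cE.
  by rewrite -[LHS]/(evalat b (dmap p g)) dmapE bE.
split=> [||n|n].
- exact: fg_sub nR _ _ _ ii fgB.
- split=> [|phi].
    apply: ker0_inj => a a0; apply: ii; rewrite linear0; apply: biB.
    rewrite linear0; apply: dual_ext => g.
    by rewrite bidualityE -dmapE -bidualityE a0.
  have [b bE] := bsB (dmap (dmap i) phi).
  have [|a aE] := pk b.
    apply: biC; rewrite linear0; apply: dual_ext => g.
    rewrite bidualityE -dmapE -bidualityE bE dmapE.
    suff -> : dmap i (dmap p g) = 0 by exact: linear0.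
    by have [_ _ -> _] := dsip.
  exists a; apply: dual_ext => f; have [g <-] := is_ f.
  by rewrite bidualityE dmapE aE -bidualityE bE dmapE.
- exact: ext_kernel sip (eB n) (eC n.+1).
- case: n => [|n]; first exact: ext0_quotient dsip (edB 0%N) exp.
  exact: ext_quotient dsip (edC n) (edB n.+1).
Qed.

Lemma projective_dual_rV n : projective (dualmod 'rV[R]_n).
Proof.
have lin : linear (fun y : 'rV[R]_n =>
    (rvlift (fun i => y 0 i : R^o) : dualmod 'rV[R]_n)).
  move=> c x y; apply: dual_ext => z.
  rewrite -[RHS]/(c *: rvlift (fun i => x 0 i : R^o) z + rvlift (fun i => y 0 i : R^o) z).
  rewrite /evalat [LHS]rvliftE [X in _ = _ *: X + _]rvliftE.
  rewrite [X in _ = _ + X]rvliftE scaler_sumr -big_split; apply: eq_bigr => i _.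
  rewrite !rvlift_delta !mxE.
  change (z 0 i * (c * x 0 i + y 0 i) = c * (z 0 i * x 0 i) + z 0 i * y 0 i).
  by rewrite mulrDr mulrCA.
apply: (@projective_iso _ _ _ (mklin lin)) (@projective_rV R n) => [x y|f].
  rewrite !mklinE => e; apply/rowP => i.
  by have := congr1 (evalat (delta_mx 0 i)) e; rewrite /evalat !rvlift_delta.
exists (\row_i evalat (delta_mx 0 i) f); rewrite mklinE; apply: dual_ext => z.
rewrite /evalat [LHS]rvliftE [RHS]rvliftE; apply: eq_bigr => i _.
by rewrite rvlift_delta mxE.
Qed.

(** Dualizing a free cover of the dual of [V] embeds the bidual, hence [V], in the dual of a free
    module; the cokernel is the dual of the totally reflexive kernel of that cover. *)
Lemma TR_embedding (nR : noetherian R) V : TR V ->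
  exists (P W : lmodType R) (i : {linear V -> P}) (p : {linear P -> W}),
    [/\ projective P, ses i p & TR W].
Proof.
move=> tV; have tdV := TR_dual nR tV.
have [[n [q qs]] _ eq _] := tdV.
have sq := ses_kinj qs.
have tL : TR (kern q) := TR_kernel nR sq (TR_rV n) tdV.
have exq : extends (kinj q) by refine (eq 0%N _ _ _ _ sq).
have dsq := dual_ses sq exq.
have [_ [bi bs] _ _] := tV.
have [di ds d0 dk] := dsq.
exists (dualmod 'rV[R]_n), (dualmod (kern q)), (dmap q \o @biduality R V),
  (dmap (kinj q)).
split; [exact: projective_dual_rV | split | exact: TR_dual].
- by move=> x y /= /di/bi.
- exact: ds.
- by move=> a; exact: d0.
- by move=> b /dk[a <-]; have [v <-] := bs a; exists v.
Qed.

End Duality.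

(** * Lifting maps from totally reflexive modules *)

Section Lifting.
Variable R : comNzRingType.
Hypothesis nR : noetherian R.
Implicit Types A B C F H K M N P V W : lmodType R.

Lemma extends_rV A B (i : {linear A -> B}) n (f : {linear A -> 'rV[R]_n}) :
  extends i -> exists g : {linear B -> 'rV[R]_n}, forall a, g (i a) = f a.
Proof.
move=> exi.
have lin (j : 'I_n) : linear (fun a => f a 0 j : R^o).
  by move=> c x y; rewrite linearP !mxE.
have /choice[g gE] j := exi (mklin (lin j)).
have glin : linear (fun b => \row_j (g j b : R)).
  by move=> c x y; apply/rowP => j; rewrite !mxE linearP.
exists (mklin glin) => a; apply/rowP => j.
by rewrite (mklinE glin) mxE gE (mklinE (lin j)).
Qed.

Lemma ext_extends_rV n A B C (i : {linear A -> B}) (p : {linear B -> C}) :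
  ses i p -> (forall k, ext k C) ->
  forall f : {linear A -> 'rV[R]_n}, exists g : {linear B -> 'rV[R]_n},
    forall a, g (i a) = f a.
Proof.
by move=> sip eC f; apply: extends_rV; refine (eC 0%N _ _ _ _ sip).
Qed.

Definition lifts H V N (q : {linear V -> N}) (f : {linear H -> N}) : Prop :=
  exists g : {linear H -> V}, forall h, q (g h) = f h.

Definition TR_lifting V N (q : {linear V -> N}) : Prop :=
  forall H (f : {linear H -> N}), TR H -> lifts q f.

Lemma projective_lifts P V N (q : {linear V -> N}) (f : {linear P -> N}) :
  projective P -> surjective q -> lifts q f.
Proof. by move=> prP qs; have [g gE] := prP _ _ q f qs; exists g => h; exact/esym/gE. Qed.

(** Any model of the quotient [N / aN], with its projection [r]. *)
Definition is_modquot N N' (a : R) (r : {linear N -> N'}) : Prop :=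
  surjective r /\ forall v, r v = 0 <-> exists u, v = a *: u.

Section Descent.
Variables (N N' : lmodType R) (a : R) (r : {linear N -> N'}).
Hypotheses (ja : in_jacobson a) (fgN : fg N) (regN : nonzerodivisor N a).
Hypotheses (rN : is_modquot a r) (rlift : TR_lifting r).
Variables (k : nat) (q : {linear 'rV[R]_k -> N}).
Hypothesis qs : surjective q.

Lemma divide_regular H (f : {linear H -> N}) :
  (forall h, exists u, f h = a *: u) ->
  exists g : {linear H -> N}, forall h, f h = a *: g h.
Proof.
move=> fa; have lin : linear (fun v : N => a *: v).
  by move=> c x y; rewrite scalerDr !scalerA mulrC.
have [|w|g gE] := @factor_inj _ _ _ _ (mklin lin) f.
- by apply: ker0_inj => u; rewrite mklinE; exact: regN.
- by have [u uE] := fa w; exists u; rewrite mklinE.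
- by exists g => h; rewrite -gE mklinE.
Qed.

(* The multiple a f extends to a projective P containing H, so modulo a it is a
   map from the totally reflexive cokernel W, to which rlift applies. *)
Lemma lifts_cancel H (f : {linear H -> N}) :
  TR H -> lifts q (a \*: f) -> lifts q f.
Proof.
move=> tH [w wE].
have [P [W [i [p [prP sip tW]]]]] := TR_embedding nR tH.
have [_ _ eW _] := tW; have [ii ps pi0 pk] := sip.
have [w' w'E] := ext_extends_rV sip eW w.
have [|v vE] := @factor_surj _ _ _ _ p (r \o q \o w') ps.
  move=> u /pk[h <-]; rewrite /= w'E wE; apply/rN.2; by exists (f h).
have [v' v'E] := rlift v tW.
have [|y yE] := @divide_regular _ ((q \o w') \- (v' \o p)).
  move=> u; apply/rN.2; rewrite linearB /= v'E vE; exact: subrr.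
have [y' y'E] := projective_lifts y prP qs.
exists (y' \o i) => h; rewrite /= y'E; apply/eqP; rewrite -subr_eq0; apply/eqP.
apply: regN; rewrite scalerBr -yE /= pi0 linear0 subr0 w'E wE.
exact: subrr.
Qed.

(* The kernel Q of s is the pullback of a free cover p of H along a : H -> H. *)
Lemma lifts_modulo H (f : {linear H -> N}) : TR H ->
  exists g : {linear H -> N}, lifts q (f \- a \*: g).
Proof.
move=> tH; have [[j [p ps]] _ eH _] := tH.
pose s : {linear prodm 'rV[R]_j H -> H} := (p \o lfst) \- (a \*: lsnd).
have ss : surjective s.
  move=> h; have [y yE] := ps h; exists (pairm y 0).
  by rewrite /= lfstE lsndE scaler0 subr0.
have sK (x : kern s) : p (lfst (kinj s x)) = a *: lsnd (kinj s x).
  by apply/eqP; rewrite -subr_eq0; apply/eqP; exact: (kinjK x).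
have tQ : TR (kern s).
  refine (TR_kernel nR (ses_kinj ss) _ tH); apply: TR_prod => //; exact: TR_rV.
pose f' : {linear kern s -> N} := f \o lsnd \o kinj s.
have [|t tE] := @lifts_cancel _ f' tQ.
  have [g gE] := projective_lifts (f \o p) (@projective_rV R j) qs.
  exists (g \o lfst \o kinj s) => x; rewrite /= gE /= sK.
  by rewrite linearZ.
(* [u] places the kernel of [p] in [kern s] as the pairs [(l, 0)], where [f'] vanishes; so
   [q \o t \o u] is zero. *)
have [|u uE] := @factor_inj _ _ _ _ (kinj s) (linl \o kinj p) (@kinj_inj _ _ _ s).
  by move=> l; apply: kerE; rewrite /= linlE lfstE lsndE scaler0 subr0 kinjK.
(* A second map into [kern s], sending [y] to [(a y, p y)]; on the kernel of [p] it agrees with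
   [a u]. *)
have dlin : linear (fun y => pairm (a *: y) (p y)).
  by move=> c y z; rewrite (linearP p) scalerDr !scalerA [a * c]mulrC -scalerA.
have [|d dE] := @factor_inj _ _ _ _ (kinj s) (mklin dlin) (@kinj_inj _ _ _ s).
  by move=> y; apply: kerE; rewrite (mklinE dlin) /= lfstE lsndE linearZ subrr.
(* Since [t'] extends [t \o u], both [t \o d - a t'] and [q \o t'] vanish on the kernel of [p] and
   descend to maps [g] and [b] on [H]; then [q \o g = f - a b]. *)
have [t' t'E] := ext_extends_rV (ses_kinj ps) eH (t \o u).
have [|g gE] := @factor_surj _ _ _ _ p ((t \o d) \- (a \*: t')) ps.
  move=> y /kerE[l <-]; rewrite /= t'E.
  have -> : d (kinj p l) = a *: u l; last by rewrite linearZ; exact: subrr.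
  apply: (@kinj_inj _ _ _ s); rewrite dE linearZ [kinj s (u l)]uE (mklinE dlin) kinjK /=.
  by rewrite linlE; congr pair; rewrite scaler0.
have [|b bE] := @factor_surj _ _ _ _ p (q \o t') ps.
  by move=> y /kerE[l <-]; rewrite /= t'E tE /= uE /= linlE lsndE linear0.
exists b; exists g => h; have [y <-] := ps h.
rewrite gE /= bE linearB /= tE /= dE (mklinE dlin) lsndE.
by rewrite linearZ.
Qed.

(** Nakayama in [Hom(H, N)], which is finitely generated, modulo the maps that lift along [q]. *)
Lemma TR_lifting_free : TR_lifting q.
Proof.
move=> H f tH; have [fgH _ _ _] := tH.
have [n [p ps]] := fg_hom nR fgH fgN.
apply: (@nakayama _ n ({linear H -> N} : lmodType R) a
  (fun i => p (delta_mx 0 i)) (fun f => lifts q (toLin f)) ja) => [c g h|||g].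
- move=> [g' gE] [h' hE]; exists ((c \*: g') \+ h') => x.
  by rewrite /= linearD linearZ /= gE hE.
- by exists \0 => x; rewrite linear0.
- move=> g; have [y <-] := ps g; exists (fun i => y 0 i), \0 => x.
  by rewrite rvliftE subrr linear0.
- exact: lifts_modulo.
Qed.

End Descent.
End Lifting.

(** * Syzygies and finite projective dimension *)

Section FiniteProjectiveDimension.
Variable R : comNzRingType.
Hypothesis nR : noetherian R.
Implicit Types A B C F H K M N P V W Z : lmodType R.

Definition TR_free_lifting N : Prop :=
  forall k (q : {linear 'rV[R]_k -> N}), surjective q -> TR_lifting q.

Lemma TR_free_lifting_iso M N (f : {linear M -> N}) :
  injective f -> surjective f -> TR_free_lifting N -> TR_free_lifting M.
Proof.
move=> fi fs lN k q qs H g tH.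
have [|h hE] := lN k (f \o q) _ H (f \o g) tH; last by exists h => x; exact/fi/hE.
by move=> y; have [v <-] := fs y; have [z <-] := qs v; exists z.
Qed.

(* Maps to the syzygy factor through a projective because a map H -> K shifts
   to a map from the cokernel of an embedding of H in a projective to M. *)
Lemma TR_free_lifting_syzygy n K M (i : {linear K -> 'rV[R]_n})
    (p : {linear 'rV[R]_n -> M}) :
  ses i p -> TR_free_lifting M -> TR_free_lifting K.
Proof.
move=> [ii ps pi0 pk] lM k q qs H f tH.
have [P [W [j [r [prP sjr tW]]]]] := TR_embedding nR tH.
have [_ _ eW _] := tW; have [ji rs rj rk] := sjr.
have [g gE] := ext_extends_rV sjr eW (i \o f).
have [|h hE] := @factor_surj _ _ _ _ r (p \o g) rs.
  by move=> u /rk[x <-]; rewrite /= gE /= pi0.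
have [s sE] := lM n p ps W h tW.
have [|t tE] := @factor_inj _ _ _ _ i (g \- (s \o r)) ii.
  by move=> u; apply: pk; rewrite linearB /= sE hE subrr.
have [u uE] := projective_lifts t prP qs.
exists (u \o j) => x; rewrite /= uE; apply: ii.
by rewrite tE /= rj linear0 subr0 gE.
Qed.

(** G-dimension at most [n] through successive kernels, so that inductions carry modules instead of
    complexes. *)
Fixpoint Gd_le n M : Prop :=
  if n is k.+1 then
    exists (Z G0 : lmodType R) (i : {linear Z -> G0}) (p : {linear G0 -> M}),
      [/\ ses i p, TR G0 & Gd_le k Z]
  else TR M.

Lemma Gd_le_resolution n (C : complex R) M (e : augmentation C M) :
  G_resolution e -> (forall k, (n < k)%N -> is_zero (C k)) -> Gd_le n M.
Proof.
elim: n C M e => [|n IH] C M e [tC exC] C0.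
  refine (TR_iso (f := e) _ exC.1 ((TRP _).1 (tC 0%N))).
  apply: ker0_inj => u u0; have [x <-] := exC.2 0%N u u0.
  by rewrite (C0 1%N _ x) // linear0.
have [e' [exC' e'E]] := tail_augmentation exC.
exists (kern e), (C 0%N), (kinj e), e; split.
- exact: ses_kinj exC.1.
- exact/TRP/tC.
- apply: (IH (complex_tail C) (kern e) e') => [|k nk]; last exact: C0.
  by split=> // k; exact: tC.
Qed.

(** The pullback of [G1] and [B] over [Z] is an extension of [G1] by [A], hence totally reflexive,
    and the kernel of its map to [B] is still [Z']. *)
Lemma Gd_le_extension n A B Z (i : {linear A -> B}) (p : {linear B -> Z}) :
  ses i p -> TR A -> Gd_le n Z -> Gd_le n B.
Proof.
case: n => [|n] sip tA; first exact: TR_extension sip tA.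
move=> [Z' [G1 [j [q [sjq tG1 Zn]]]]].
have [W [w1 [w2 pb]]] := pullback_exists q p.
have [k sk _] := pullback_ses pb sjq.
have [l sl _] := pullback_ses (is_pullbackC pb) sip.
by exists Z', W, k, w2; split=> //; exact: TR_extension sl tA tG1.
Qed.

(** A free cover of [G0] replaces [G0]; the new syzygy is an extension of [Z] by the kernel of that
    cover, which is totally reflexive. *)
Lemma Gd_le_syzygy n M : Gd_le n.+1 M ->
  exists k K (i : {linear K -> 'rV[R]_k}) (p : {linear 'rV[R]_k -> M}),
    ses i p /\ Gd_le n K.
Proof.
move=> [Z [G0 [i [p [sip tG0 Zn]]]]].
have [[k [q qs]] _ _ _] := tG0; have [ii ps pi0 pk] := sip.
have pqs : surjective (p \o q).
  by move=> m; have [x <-] := ps m; have [y <-] := qs x; exists y.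
have [s [t [sst _ _]]] := ses_comp_surj sip (ses_kinj qs) (ses_kinj pqs).
exists k, (kern (p \o q)), (kinj (p \o q)), (p \o q).
split; first exact: ses_kinj.
apply: Gd_le_extension sst _ Zn.
by refine (TR_kernel nR (ses_kinj qs) (@TR_rV R k) tG0).
Qed.

Lemma pdim_le_splice n K P M (i : {linear K -> P}) (p : {linear P -> M}) :
  projective P -> ses i p -> pdim_le K n -> pdim_le M n.+1.
Proof.
move=> prP sip [C [e [[prC exC] C0]]].
have [e' [e'' ex'']] := splice sip exC.
exists (augmented e'), e''; split; first by split=> // -[|k]; last exact: prC.
by case=> // k nk; exact: (C0 k nk).
Qed.

Lemma pdim_le0 P : projective P -> pdim_le P 0.
Proof.
move=> prP.
have z0 : is_zero (mod0 R) by move=> x; apply/rowP; case.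
(* The zero complex resolves the zero module; spliced with [0 -> P -> P] it yields [P] concentrated
   in degree 0. *)
pose C := @Complex R (fun=> mod0 R) (fun=> \0) (fun _ _ => erefl).
pose e := @Augmentation R C (mod0 R) \0 (fun=> erefl).
have exC : exact_complex (augmented e).
  split=> [y|n y _]; exists 0; first by rewrite [y]z0 linear0.
  by case: n y => [|n] y; rewrite [y]z0 linear0.
have sP : ses (\0 : {linear mod0 R -> P}) (idfun : {linear P -> P}).
  split=> [x y _|v|//|b /= ->]; [by rewrite [x]z0 [y]z0 | by exists v | by exists 0].
have [e' [e'' ex'']] := splice sP exC.
exists (augmented e'), e''; split; last by case.
by split=> // -[|k] //; exact: projective_is_zero.
Qed.

Lemma Gd_le_pdim n M : Gd_le n M -> TR_free_lifting M -> pdim_le M n.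
Proof.
elim: n M => [|n IH] M Mn lM.
  apply: pdim_le0; have [[k [q qs]] _ _ _] := Mn.
  have [s sE] := lM k q qs M idfun Mn.
  exact: projective_retract sE (@projective_rV R k).
have [k [K [i [p [sip Kn]]]]] := Gd_le_syzygy Mn.
refine (pdim_le_splice (@projective_rV R k) sip (IH _ Kn _)).
exact: TR_free_lifting_syzygy sip lM.
Qed.

End FiniteProjectiveDimension.

(** * Regular sequences *)

Section RegularSequences.
Variable R : comNzRingType.
Implicit Types (M N : lmodType R) (s t : seq R) (a b : R).

Lemma span_min (V : lmodType R) (A T : set V) v :
  T 0 -> (forall c x y, T x -> T y -> T (c *: x + y)) ->
  (forall x, A x -> T x) -> v \in span A -> T v.
Proof.
move=> T0 Tl AT /spanP[n [c [u [Au ->]]]].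
apply: (big_ind T) => // [x y Tx Ty|i _]; first by rewrite -[x]scale1r; exact: Tl.
by rewrite -[_ *: _]addr0; apply: Tl => //; exact: AT.
Qed.

(** An equality of sets, so that rewriting identifies the modules [qseq M s] and [qseq M t]
    themselves. *)
Lemma seq_mul_eq M s t : s =i t -> @seq_mul R s M = @seq_mul R t M.
Proof.
move=> st; apply/seteqP; split=> v [a as_ [u uE]]; exists a.
- by rewrite -st.
- by exists u.
- by rewrite st.
- by exists u.
Qed.

Definition qsproj M t : {linear M -> qseq M t} := qproj (@seq_mul R t M).

Lemma qsproj_surj M t : surjective (qsproj M t).
Proof. by move=> x; have [v ->] := qprojP x; exists v. Qed.

Lemma qsproj_eq0 M t v : qsproj M t v = 0 <-> v \in span (@seq_mul R t M).
Proof.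
rewrite -{1}[0](linear0 (qsproj M t)) -[v in X in _ <-> X]subr0.
exact: qproj_eq.
Qed.

Lemma span_seq_mul_cons M t a v : v \in span (@seq_mul R (a :: t) M) <->
  exists u, v - a *: u \in span (@seq_mul R t M).
Proof.
split=> [|[u uv]].
  pose T v := exists u, v - a *: u \in span (@seq_mul R t M).
  move=> vS; apply: (span_min (T := T) _ _ _ vS).
  - by exists 0; rewrite scaler0 subr0 rpred0.
  - move=> c x y [u xu] [w yw]; exists (c *: u + w).
    have -> : c *: x + y - a *: (c *: u + w) = c *: (x - a *: u) + (y - a *: w).
      by rewrite scalerBr scalerDr opprD addrACA !scalerA [a * c]mulrC.
    by rewrite rpredD // rpredZ.
  - move=> x [b]; rewrite inE => /orP[/eqP->|bt] [u ->].
      by exists u; rewrite subrr rpred0.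
    by exists 0; rewrite scaler0 subr0; apply: mem_span; exists b => //; exists u.
rewrite -[v](subrK (a *: u)) rpredD //; last first.
  by apply: mem_span; exists a; [rewrite inE eqxx | exists u].
apply: (span_min (T := fun v => v \in span (@seq_mul R (a :: t) M)) _ _ _ uv).
- exact: rpred0.
- by move=> c x y xS yS; rewrite rpredD // rpredZ.
- move=> x [b bt [w ->]]; apply: mem_span; exists b; last by exists w.
  by rewrite inE bt orbT.
Qed.

Lemma qseq_modquot M t a : exists r : {linear qseq M t -> qseq M (a :: t)},
  is_modquot a r /\ forall v, r (qsproj M t v) = qsproj M (a :: t) v.
Proof.
have [|r rE] := @factor_surj _ _ _ _ (qsproj M t) (qsproj M (a :: t)) (@qsproj_surj M t).
  move=> v /qsproj_eq0 v0; apply/qsproj_eq0/span_seq_mul_cons.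
  by exists 0; rewrite scaler0 subr0.
exists r; split=> //; split=> [x|x].
  by have [v <-] := qsproj_surj x; exists (qsproj M t v).
have [v <-] := qsproj_surj x; rewrite rE qsproj_eq0 span_seq_mul_cons.
split=> [[u]|[y]]; last have [u <-] := qsproj_surj y.
  move=> /qsproj_eq0; rewrite linearB linearZ /= => /eqP; rewrite subr_eq0 => /eqP ->.
  by exists (qsproj M t u).
move=> e; exists u; apply/qsproj_eq0.
by rewrite linearB linearZ /= e subrr.
Qed.

(** [t] collects the elements already divided out, the most recent first. *)
Fixpoint regular_over M t s : Prop :=
  if s is a :: s' then nonzerodivisor (qseq M t) a /\ regular_over M (a :: t) s'
  else True.

Lemma regular_over_eq M t t' s : t =i t' -> regular_over M t s -> regular_over M t' s.
Proof.
elim: s t t' => //= a s IH t t' tt' [ra rs]; split.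
  by move: ra; rewrite /qseq (seq_mul_eq M tt').
by apply: IH rs => b; rewrite !inE tt'.
Qed.

Lemma regular_sequence_over M t s :
  (forall i, (i < size s)%N -> nonzerodivisor (qseq M (take i s ++ t)) s`_i) ->
  regular_over M t s.
Proof.
elim: s t => //= a s IH t rs; split; first exact: (rs 0%N).
apply: IH => i si; have := rs i.+1 si; rewrite /= /qseq.
rewrite (@seq_mul_eq M (a :: take i s ++ t) (take i s ++ a :: t)) // => b.
by rewrite !(inE, mem_cat) orbCA.
Qed.

Hypothesis nR : noetherian R.

Lemma fg_qseq M t : fg M -> fg (qseq M t).
Proof. exact/fg_surj/qsproj_surj. Qed.

(** If [b u = 0], then [u = a w] because [b] is regular on [N/aN], and [b w = 0] because [a] is
    regular on [N]. So the kernel of [b] equals [a] times itself and vanishes by Nakayama.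
    Regularity of [a] on [N/bN] is then a division argument. *)
Lemma nonzerodivisor_swap a b (N Na Nb : lmodType R) (ra : {linear N -> Na})
    (rb : {linear N -> Nb}) :
  fg N -> in_jacobson a -> is_modquot a ra -> is_modquot b rb ->
  nonzerodivisor N a -> nonzerodivisor Na b ->
  nonzerodivisor N b /\ nonzerodivisor Nb a.
Proof.
move=> fgN ja [_ rak] [rbs rbk] na nb.
have bN : nonzerodivisor N b.
  have lin : linear (fun v : N => b *: v).
    by move=> c x y; rewrite scalerDr !scalerA mulrC.
  pose f := mklin lin.
  have [n [p ps]] := fg_sub nR (@kinj_inj _ _ _ f) fgN.
  have K0 (x : kern f) : x = 0.
    apply: (@nakayama _ n _ a (fun i => p (delta_mx 0 i)) (fun x => x = 0) ja) => //.
    - by move=> c u v -> ->; rewrite scaler0 addr0.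
    - by move=> u; have [y <-] := ps u; exists (fun i => y 0 i); rewrite rvliftE subrr.
    - move=> u; have bu : b *: kinj f u = 0 by rewrite -(mklinE lin) [f _]kinjK.
      have [w wE] : exists w, kinj f u = a *: w.
        by apply/rak; apply: nb; rewrite -linearZ /= bu linear0.
      have [|k kE] := @kerE _ _ _ f w.
        by rewrite (mklinE lin); apply: na; rewrite scalerA mulrC -scalerA -wE.
      by exists k; apply: kinj_inj; rewrite linearB linearZ /= kE wE subrr linear0.
  move=> u bu; have [|k <-] := @kerE _ _ _ f u; first by rewrite (mklinE lin).
  by rewrite (K0 k) linear0.
split=> // x ax; have [n nx] := rbs x.
have [n' n'E] : exists n', a *: n = b *: n'.
  by apply/rbk; rewrite linearZ /= nx.
have [n'' n''E] : exists n'', n' = a *: n''.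
  by apply/rak; apply: nb; rewrite -linearZ /= -n'E; apply/rak; exists n.
rewrite -nx; apply/rbk; exists n''; apply/eqP; rewrite -subr_eq0; apply/eqP.
by apply: na; rewrite scalerBr n'E n''E !scalerA mulrC subrr.
Qed.

(** [a] is exchanged with one element of [s] at a time until it comes last. *)
Lemma regular_over_swap M t s a : fg M -> in_jacobson a ->
  nonzerodivisor (qseq M t) a -> regular_over M (a :: t) s ->
  nonzerodivisor (qseq M (s ++ t)) a /\ regular_over M t s.
Proof.
move=> fgM ja; elim: s t => [//|b s IH] t na [nb rs].
have [ra [qa _]] := qseq_modquot M t a; have [rb [qb _]] := qseq_modquot M t b.
have [nb' na'] := nonzerodivisor_swap (fg_qseq _ fgM) ja qa qb na nb.
have [|na'' rs'] := IH (b :: t) na'.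
  by apply: regular_over_eq rs => c; rewrite !inE orbCA.
split=> //; move: na''; rewrite /qseq.
rewrite (@seq_mul_eq M (s ++ b :: t) ((b :: s) ++ t)) // => c.
by rewrite !(inE, mem_cat) orbCA.
Qed.

(** Regularity in the order in which the cones are formed, from the last element to the first. *)
Fixpoint coregular M s : Prop :=
  if s is a :: s' then nonzerodivisor (qseq M s') a /\ coregular M s' else True.

Lemma regular_over_coregular M s : fg M -> (forall a, a \in s -> in_jacobson a) ->
  regular_over M [::] s -> coregular M s.
Proof.
move=> fgM; elim: s => //= a s IH js [na rs].
have [|na' rs'] := regular_over_swap fgM _ na rs; first by apply: js; rewrite inE eqxx.
rewrite cats0 in na'; split=> //; apply: IH rs' => b bs.
by apply: js; rewrite inE bs orbT.
Qed.

Lemma TR_free_lifting_qseq M t a : fg M -> in_jacobson a ->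
  nonzerodivisor (qseq M t) a -> TR_lifting (qsproj M (a :: t)) ->
  TR_free_lifting (qseq M t).
Proof.
move=> fgM ja na lM k q qs.
have [r [qr rE]] := qseq_modquot M t a.
apply: (TR_lifting_free nR ja (fg_qseq _ fgM) na qr) => // H f tH.
by have [g gE] := lM H f tH; exists (qsproj M t \o g) => h; rewrite /= rE gE.
Qed.

(** Descent starts at the end of the sequence. Once maps into [qseq M (a :: t)] lift to its free
    covers they lift to [M], since one such cover factors through [M]; this feeds the next descent.
    [catrev] is the order in which [regular_over] stacks the elements. *)
Lemma TR_free_lifting_regular M a s t : fg M ->
  (forall b, b \in a :: s -> in_jacobson b) -> regular_over M t (a :: s) ->
  TR_lifting (qsproj M (catrev s (a :: t))) -> TR_free_lifting (qseq M t).
Proof.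
move=> fgM; elim: s a t => [|b s IH] a t js [na rs] lM.
  by apply: TR_free_lifting_qseq na lM => //; apply: js; rewrite inE eqxx.
apply: TR_free_lifting_qseq na _ => //; first by apply: js; rewrite inE eqxx.
have lN : TR_free_lifting (qseq M (a :: t)).
  by apply: IH rs lM => c cs; apply: js; rewrite inE cs orbT.
move=> H f tH; have [n [p ps]] := fgM.
have [|g gE] := lN n (qsproj M (a :: t) \o p) _ H f tH; last by exists (p \o g).
move=> x; have [v <-] := qsproj_surj x.
by have [y <-] := ps v; exists y.
Qed.

End RegularSequences.

(** * Mapping cones and Koszul complexes *)

Section Cones.
Variable R : comNzRingType.
Implicit Types (C T D L G : complex R) (M N V W X : lmodType R) (a : R).

Definition jointly_bijective (V V1 V2 : lmodType R) (f : {linear V -> V1})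
    (g : {linear V -> V2}) : Prop :=
  (forall x y, exists2 v, f v = x & g v = y) /\
  (forall v, f v = 0 -> g v = 0 -> v = 0).

(* T is the mapping cone of multiplication by a on C, up to an isomorphism
   given by its components rho (into C_n) and beta (into C_(n-1)). *)
Definition is_cone a C T (rho : forall n, {linear T n -> C n})
    (beta : forall n, {linear T n.+1 -> C n}) : Prop :=
  [/\ injective (rho 0%N) /\ surjective (rho 0%N),
      forall n, jointly_bijective (rho n.+1) (beta n),
      forall n t, rho n (cdiff T n t) = cdiff C n (rho n.+1 t) + a *: beta n t &
      forall n t, beta n (cdiff T n.+1 t) = - cdiff C n (beta n.+1 t)].

(** In the long exact sequence of the cone only [N], the homology of [C] in degree 0, contributes:
    the cokernel of [a] on [N] becomes [H_0], and the kernel, which would be [H_1], is zero. *)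
Lemma cone_exact a C T rho beta N N' (e : augmentation C N) (r : {linear N -> N'}) :
  @is_cone a C T rho beta -> exact_complex (augmented e) ->
  nonzerodivisor N a -> is_modquot a r ->
  exists e' : augmentation T N', exact_complex (augmented e') /\
    forall t, e' t = r (e (rho 0%N t)).
Proof.
move=> [[ri rs] rb rd bd] [es ex] na [rs' rk].
have eK t : (r \o e \o rho 0%N) (cdiff T 0 t) = 0.
  rewrite /= rd linearD augK add0r; apply/rk; exists (e (beta 0%N t)).
  by rewrite linearZ.
exists (@Augmentation R T N' (r \o e \o rho 0%N) eK); split=> //.
(* A cycle whose [beta] component is the boundary of [y] is a boundary: [z] bounds its [rho]
   component corrected by [a y], and [- y] absorbs the sign of the shifted differential. *)
have key n (t : T n.+1) y : cdiff T n t = 0 -> beta n t = cdiff C n y ->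
    exists x, cdiff T n.+1 x = t.
  move=> t0 bt; have := rd n t; rewrite t0 linear0 bt => /esym.
  rewrite -linearZ -linearD => /(ex n.+1 (rho n.+1 t + a *: y))[z zE].
  have {}zE : cdiff C n.+1 z = rho n.+1 t + a *: y by exact: zE.
  have [x xz xy] := (rb n.+1).1 z (- y).
  exists x; apply/eqP; rewrite -subr_eq0; apply/eqP/(rb n).2.
    by rewrite linearB /= rd xz xy zE scalerN addrK subrr.
  by rewrite linearB /= bd xy linearN opprK bt subrr.
split=> [v|[|[|n]] t t0].
- have [w <-] := rs' v; have [c <-] := es w; have [t <-] := rs c; by exists t.
- have /rk[w wE] : r (e (rho 0%N t)) = 0 by exact: t0.
  have [c cE] := es w.
  have {}cE : e c = w by exact: cE.
  have [|z zE] := ex 0%N (rho 0%N t - a *: c).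
    by rewrite /= linearB linearZ /= cE wE subrr.
  have {}zE : cdiff C 0 z = rho 0%N t - a *: c by exact: zE.
  have [x xz xc] := (rb 0%N).1 z c; exists x; apply: ri.
  by rewrite rd xz xc zE subrK.
- have t0' : cdiff T 0 t = 0 by exact: t0.
  have [|y yE] := ex 0%N (beta 0%N t).
    apply: na; have := congr1 e (rd 0%N t); rewrite t0' !linear0 linearD augK add0r.
    by rewrite linearZ => /esym.
  exact: (key 0%N t y t0' (esym yE)).
- have t0' : cdiff T n.+1 t = 0 by exact: t0.
  have [|y yE] := ex n.+1 (beta n.+1 t).
    by have := bd n t; rewrite t0' linear0 => /eqP; rewrite eq_sym oppr_eq0 => /eqP.
  exact: (key n.+1 t y t0' (esym yE)).
Qed.

Lemma TR_iso' V W (f : {linear V -> W}) :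
  injective f -> surjective f -> TR W -> TR V.
Proof.
move=> fi fs tW; have [|g gE] := @factor_inj _ _ _ _ f idfun fi.
  by move=> w; have [v <-] := fs w; exists v.
apply: (TR_iso (f := g)) tW => [w w' e|v]; first by rewrite -[w]gE -[w']gE e.
by exists (f v); apply: fi; rewrite gE.
Qed.

Lemma jointly_bijective_inv (V V1 V2 : lmodType R) (f : {linear V -> V1})
    (g : {linear V -> V2}) : jointly_bijective f g ->
  exists (h : {linear V1 -> V}) (k : {linear V2 -> V}),
    [/\ forall x, f (h x) = x, forall x, g (h x) = 0, forall y, f (k y) = 0,
        forall y, g (k y) = y & forall v, v = h (f v) + k (g v)].
Proof.
move=> [ex inj].
have lin : linear (fun v => pairm (f v) (g v)).
  by move=> c u v; rewrite !linearP.
have [| |i iE] := @factor_inj _ _ _ _ (mklin lin) idfun.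
- move=> u v; rewrite !(mklinE lin) => -[e1 e2].
  apply/eqP; rewrite -subr_eq0; apply/eqP/inj; rewrite linearB.
    by rewrite e1 subrr.
  by rewrite e2 subrr.
- move=> w; have [v e1 e2] := ex (lfst w) (lsnd w).
  by exists v; rewrite (mklinE lin) e1 e2 /= -pairm_eta.
have iE' w : f (i w) = lfst w /\ g (i w) = lsnd w.
  have e := iE w; rewrite (mklinE lin) in e.
  by have := (congr1 lfst e, congr1 lsnd e); rewrite lfstE lsndE => -[].
exists (i \o linl), (i \o linr); split=> [x|x|y|y|v] /=.
- by rewrite (iE' _).1 linlE lfstE.
- by rewrite (iE' _).2 linlE lsndE.
- by rewrite (iE' _).1 linrE lfstE.
- by rewrite (iE' _).2 linrE lsndE.
apply/eqP; rewrite -subr_eq0; apply/eqP/inj.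
  by rewrite linearB linearD /= !(iE' _).1 linlE linrE !lfstE addr0 subrr.
by rewrite linearB linearD /= !(iE' _).2 linlE linrE !lsndE add0r subrr.
Qed.

(** In positive degrees the cone is an extension of [C n] by [C n.+1]. *)
Lemma cone_TR a C T rho beta : @is_cone a C T rho beta ->
  (forall n, TR (C n)) -> forall n, TR (T n).
Proof.
move=> [[ri rs] rb _ _] tC [|n]; first exact: TR_iso' ri rs (tC 0%N).
have [h [k [fh gh fk gk E]]] := jointly_bijective_inv (rb n).
have s : ses h (beta n).
  split=> [x y e|y|x|b b0].
  - by rewrite -[x]fh e fh.
  - by exists (k y).
  - exact: gh.
  - by exists (rho n.+1 b); rewrite [RHS]E b0 linear0 addr0.
exact: TR_extension s (tC n.+1) (tC n).
Qed.

End Cones.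

(** * Tensor products: universal property and unit isomorphisms *)

Section TensorTheory.
Variable R : comNzRingType.
Implicit Types (V W U X : lmodType R).

Lemma tensor_lift V W U (b : V -> W -> U) :
  (forall w, linear (b^~ w)) -> (forall v, linear (b v)) ->
  exists f : {linear tensor V W -> U}, forall v w, f (tpure v w) = b v w.
Proof.
move=> bl br; pose g (p : V * W) := b p.1 p.2.
have E v w : frlift g (fpure v w) = b v w by exact: frliftE.
have bZl c v w : b (c *: v) w = c *: b v w.
  have b0 : b 0 w = 0.
    have := bl w 1 0 0; rewrite /= !scale1r addr0 => /eqP.
    by rewrite eq_sym -subr_eq0 addrK => /eqP.
  by have := bl w c v 0; rewrite /= addr0 b0 addr0.
have bZr c v w : b v (c *: w) = c *: b v w.
  have b0 : b v 0 = 0.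
    have := br v 1 0 0; rewrite /= !scale1r addr0 => /eqP.
    by rewrite eq_sym -subr_eq0 addrK => /eqP.
  by have := br v c w 0; rewrite /= addr0 b0 addr0.
have bDl v v' w : b (v + v') w = b v w + b v' w.
  by have := bl w 1 v v'; rewrite /= !scale1r.
have bDr v w w' : b v (w + w') = b v w + b v w'.
  by have := br v 1 w w'; rewrite /= !scale1r.
have gP D : bilinear_rel D -> frlift g D = 0.
  by case=> [[v [v' [w]]]|[v [w [w']]]|[c [v [w]]]|[c [v [w]]]] ->;
    rewrite !(linearB, linearZ) /= !E ?bDl ?bDr ?bZl ?bZr;
    rewrite ?scalerN ?subrr // -addrA -opprD subrr.
exists (mklin (qlift_linear gP)) => v w.
by rewrite (mklinE (qlift_linear gP)) /tpure (qliftE gP); exact: E.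
Qed.

Lemma tpureZl V W c (v : V) (w : W) : tpure (c *: v) w = c *: tpure v w.
Proof. by case: (tpureP v w) => _ [_ []]. Qed.
Lemma tpureZr V W c (v : V) (w : W) : tpure v (c *: w) = c *: tpure v w.
Proof. by case: (tpureP v w) => _ [_ []]. Qed.
Lemma tpureDl V W (v v' : V) (w : W) : tpure (v + v') w = tpure v w + tpure v' w.
Proof. by case: (tpureP v w). Qed.
Lemma tpureDr V W (v : V) (w w' : W) : tpure v (w + w') = tpure v w + tpure v w'.
Proof. by case: (tpureP v w) => _ []. Qed.

Lemma tensor_regularl V : exists f : {linear tensor (R^o : lmodType R) V -> V},
  (forall r v, f (tpure r v) = r *: v) /\
  (forall t, tpure (1 : R^o) (f t) = t).
Proof.
have [||f fE] := @tensor_lift R^o V V (fun r v => r *: v).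
- by move=> v c r s; rewrite scalerDl scalerA.
- by move=> r c v w; rewrite scalerDr !scalerA mulrC.
exists f; split=> // t.
have lin : linear (fun t => tpure (1 : R^o) (f t)).
  by move=> c s u; rewrite linearP tpureDr tpureZr.
have := tensor_ext (f := mklin lin) (g := idfun) _ t.
rewrite (mklinE lin); apply=> r v; rewrite (mklinE lin) fE tpureZr -tpureZl.
by congr tpure; exact: mulr1.
Qed.

Lemma tensor_regularr V : exists f : {linear tensor V (R^o : lmodType R) -> V},
  (forall v r, f (tpure v r) = r *: v) /\
  (forall t, tpure (f t) (1 : R^o) = t).
Proof.
have [||f fE] := @tensor_lift V R^o V (fun v r => r *: v).
- by move=> r c v w; rewrite scalerDr !scalerA mulrC.
- by move=> v c r s; rewrite scalerDl scalerA.
exists f; split=> // t.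
have lin : linear (fun t => tpure (f t) (1 : R^o)).
  by move=> c s u; rewrite linearP tpureDl tpureZl.
have := tensor_ext (f := mklin lin) (g := idfun) _ t.
rewrite (mklinE lin); apply=> v r; rewrite (mklinE lin) fE tpureZl -tpureZr.
by congr tpure; exact: mulr1.
Qed.

Lemma tensor_zerol V W : is_zero V -> is_zero (tensor V W).
Proof.
move=> V0 t; apply: (tensor_ext (f := idfun) (g := \0)) => v w /=.
by rewrite (V0 v) -(scale0r 0) tpureZl scale0r.
Qed.

Lemma tensor_zeror V W : is_zero W -> is_zero (tensor V W).
Proof.
move=> W0 t; apply: (tensor_ext (f := idfun) (g := \0)) => v w /=.
by rewrite (W0 w) -(scale0r 0) tpureZr scale0r.
Qed.

End TensorTheory.

(** * Koszul factors as mapping cones, and tensoring a cone with a complex *)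

Section KoszulCone.
Variable R : comNzRingType.
Implicit Types (C T D L G : complex R) (M N V W X Y : lmodType R) (a : R).

(** Paths to the same bidegree produce different proofs of the degree equation; this identifies the
    components. *)
Lemma bideg_irr C D n (t : tens_obj C D n) q (h h' : (q.1 + q.2 == n)%N) :
  t (exist _ q h) = t (exist _ q h') :> tensor (C q.1) (D q.2).
Proof. by rewrite (bool_irrelevance h h'). Qed.

Section KoszulFactor.
Variables (a : R) (L : complex R).
Let T := tensor_complex (koszul1 a) L.

Definition bideg0 n : bideg n := exist _ (0, n)%N (eqxx n).

Fact proj_comp_linear n (p : bideg n) V
    (f : {linear tensor (koszul1 a (val p).1) (L (val p).2) -> V}) :
  linear (fun t : T n => f (t p)).
Proof. by move=> c s t; rewrite -linearP. Qed.

Definition proj_comp n (p : bideg n) V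
    (f : {linear tensor (koszul1 a (val p).1) (L (val p).2) -> V}) :
  {linear T n -> V} := mklin (proj_comp_linear f).

(** [koszul1 a] lives in degrees 0 and 1, so only the components with first degree 0 or 1 survive;
    they give [rho] and [beta] once [R] tensored with a module is identified with that module. The
    minus sign is the tensor sign of degree 1. *)
Lemma koszul1_cone : exists rho beta, @is_cone R a L T rho beta.
Proof.
pose isc V (f : {linear tensor (R^o : lmodType R) V -> V}) :=
  (forall r v, f (tpure r v) = r *: v) /\ (forall t, tpure (1 : R^o) (f t) = t).
have /all_sig[c cE] n : {c | isc (L n) c} := cid (tensor_regularl (L n)).
pose rho n : {linear T n -> L n} := @proj_comp n (bideg0 n) _ (c n).
pose beta n : {linear T n.+1 -> L n} := @proj_comp n.+1 (shl (bideg0 n)) _ (c n).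
have rhoE n t : rho n t = c n (t (bideg0 n)) by rewrite /rho /proj_comp mklinE.
have betaE n t : beta n t = c n (t (shl (bideg0 n))) by rewrite /beta /proj_comp mklinE.
have c_inj n : injective (c n).
  by move=> s t e; rewrite -[s](cE n).2 -[t](cE n).2 e.
have c1 n v : c n (tpure (1 : R^o) v) = v by rewrite (cE n).1 scale1r.
have big0 n k l (h : (k.+2 + l == n)%N) (t : T n) : t (exist _ (k.+2, l) h) = 0.
  by apply: tensor_zerol => x; apply/rowP; case.
have c_diff n s : c n (tmap idfun (cdiff L n) s) = cdiff L n (c n.+1 s).
  apply: (tensor_ext (f := c n \o tmap idfun (cdiff L n)) (g := cdiff L n \o c n.+1)).
  by move=> r v /=; rewrite tmapE (cE n).1 (cE n.+1).1 linearZ.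
have c_scale n s : c n (tmap (cdiff (koszul1 a) 0) idfun s) = a *: c n s.
  apply: (tensor_ext (f := c n \o tmap (cdiff (koszul1 a) 0) idfun) (g := a \*: c n)).
  by move=> r v /=; rewrite tmapE !(cE n).1 /= scalerA.
(* The element with component [s] in bidegree [p] and zero elsewhere; sums of two of these realize
   prescribed values of [rho] and [beta]. *)
pose single n (p : bideg n) (s : tensor (koszul1 a (val p).1) (L (val p).2)) : T n :=
  @dfwith (bideg n) (fun p => tensor (koszul1 a (val p).1) (L (val p).2)) (fun=> 0) p s.
have single_in n (p : bideg n) s : single n p s p = s.
  exact: (@dfwith_in (bideg n) (fun p => tensor (koszul1 a (val p).1) (L (val p).2))).
have single_out n (p q : bideg n) s : p != q -> single n p s q = 0.
  exact: (@dfwith_out (bideg n) (fun p => tensor (koszul1 a (val p).1) (L (val p).2))).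
exists rho, beta; split.
- split=> [s t|v].
    rewrite !rhoE => /c_inj st; apply: dprod_ext => -[[k l] h].
    have k0 : k = 0%N by move: h => /=; rewrite addn_eq0 => /andP[/eqP].
    have l0 : l = 0%N by move: h => /=; rewrite addn_eq0 => /andP[_ /eqP].
    move: h; rewrite k0 l0 => h.
    by rewrite (bideg_irr s h (eqxx 0%N)) (bideg_irr t h (eqxx 0%N)).
  exists (single _ (bideg0 0) (tpure (1 : R^o) v)).
  by rewrite rhoE single_in c1.
- move=> n; split=> [x y|t].
    exists (single _ (bideg0 n.+1) (tpure (1 : R^o) x) +
            single _ (shl (bideg0 n)) (tpure (1 : R^o) y)); rewrite ?rhoE ?betaE.
      rewrite -[X in c _ X = _]/(single _ _ _ _ + single _ _ _ _).
      by rewrite single_in single_out // addr0 c1.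
    rewrite -[X in c _ X = _]/(single _ _ _ _ + single _ _ _ _).
    by rewrite single_in single_out // add0r c1.
  rewrite rhoE betaE => t0 t1; apply: dprod_ext => -[[[|[|k]] l] h]; last exact: big0.
    have ln : l = n.+1 by apply/eqP.
    move: h; rewrite ln => h; rewrite (bideg_irr t h (eqxx n.+1)).
    by apply: (c_inj n.+1); rewrite [RHS]linear0; exact: t0.
  have ln : l = n by apply/eqP.
  move: h; rewrite ln => h; rewrite (bideg_irr t (q := (1, n)%N) h (valP (bideg0 n))).
  by apply: (c_inj n); rewrite [RHS]linear0; exact: t1.
- move=> n t; rewrite !rhoE betaE.
  rewrite -[cdiff T n t _]/(tmap (cdiff (koszul1 a) 0) idfun (t (shl (bideg0 n))) +
    (-1) ^+ 0 *: tmap idfun (cdiff L n) (t (shr (bideg0 n)))).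
  rewrite expr0 scale1r linearD c_scale c_diff addrC; congr (cdiff L n (c n.+1 _) + _).
  exact: (bideg_irr t (q := (0, n.+1)%N)).
- move=> n t; rewrite !betaE.
  rewrite -[cdiff T n.+1 t _]/(tmap (cdiff (koszul1 a) 1) idfun (t (shl (shl (bideg0 n)))) +
    (-1) ^+ 1 *: tmap idfun (cdiff L n) (t (shr (shl (bideg0 n))))).
  rewrite tmap0l // add0r expr1 scaleN1r linearN c_diff; congr (- cdiff L n (c n.+1 _)).
  exact: (bideg_irr t (q := (1, n.+1)%N)).
Qed.

End KoszulFactor.

Section TensorCone.
Variables (a : R) (G L D : complex R).
Variables (rho : forall n, {linear D n -> L n}) (beta : forall n, {linear D n.+1 -> L n}).
Hypothesis cone : is_cone a rho beta.
Let C := tensor_complex G L.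
Let T := tensor_complex G D.

Fact tens_rho_linear n :
  linear (fun t : T n => (fun p => tmap idfun (rho (val p).2) (t p)) : C n).
Proof. by move=> c s t; apply: dprod_ext => p; exact: linearP. Qed.

(** The sign cancels the one in the tensor differential; without it, multiplication by [a] would
    enter with alternating signs. *)
Fact tens_beta_linear n : linear (fun t : T n.+1 =>
  (fun p => (-1) ^+ (val p).1 *: tmap idfun (beta (val p).2) (t (shr p))) : C n).
Proof.
move=> c s t; apply: dprod_ext => p.
change ((-1) ^+ (val p).1 *: tmap idfun (beta (val p).2) (c *: s (shr p) + t (shr p)) =
  c *: ((-1) ^+ (val p).1 *: tmap idfun (beta (val p).2) (s (shr p))) +
  (-1) ^+ (val p).1 *: tmap idfun (beta (val p).2) (t (shr p))).
by rewrite linearP scalerDr !scalerA [c * _]mulrC.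
Qed.

Definition tens_rho n : {linear T n -> C n} := mklin (@tens_rho_linear n).
Definition tens_beta n : {linear T n.+1 -> C n} := mklin (@tens_beta_linear n).

Lemma tens_rhoE n t p : tens_rho n t p = tmap idfun (rho (val p).2) (t p).
Proof. by rewrite /tens_rho mklinE. Qed.

Lemma tens_betaE n t p : tens_beta n t p =
  (-1) ^+ (val p).1 *: tmap idfun (beta (val p).2) (t (shr p)).
Proof. by rewrite /tens_beta mklinE. Qed.

Lemma signK (V : lmodType R) i (v : V) : (-1) ^+ i *: ((-1) ^+ i *: v) = v.
Proof. by rewrite scalerA -expr2 sqrr_sign scale1r. Qed.

Lemma tmapK X V W (f : {linear V -> W}) (g : {linear W -> V}) (t : tensor X V) :
  (forall v, g (f v) = v) -> tmap idfun g (tmap idfun f t) = t.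
Proof.
move=> gf; rewrite tmap_comp; apply: (tensor_ext (f := tmap _ _) (g := idfun)) => x v.
by rewrite /= tmapE /= gf.
Qed.

Lemma tmapC X Y V W (f : {linear X -> Y}) (g : {linear V -> W}) (t : tensor X V) :
  tmap idfun g (tmap f idfun t) = tmap f idfun (tmap idfun g t).
Proof. by rewrite !tmap_comp; exact: eq_tmap. Qed.

(** Tensoring preserves direct sum decompositions: inverses chosen in each degree of [D] are
    tensored with [G], and the differential identities are checked one bidegree at a time. *)
Lemma tensor_cone : is_cone a tens_rho tens_beta.
Proof.
have [[ri0 rs0] rb rd bd] := cone.
have [|k0 k0E] := @factor_inj _ _ _ _ (rho 0%N) idfun ri0.
  by move=> w; have [v <-] := rs0 w; exists v.
pose is_inv n (hk : {linear L n.+1 -> D n.+1} * {linear L n -> D n.+1}) :=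
  [/\ forall x, rho n.+1 (hk.1 x) = x, forall x, beta n (hk.1 x) = 0,
    forall y, rho n.+1 (hk.2 y) = 0, forall y, beta n (hk.2 y) = y &
    forall v, v = hk.1 (rho n.+1 v) + hk.2 (beta n v)].
have /all_sig[hk hkE] n : {hk | is_inv n hk}.
  apply: cid; have [h [k hkP]] := jointly_bijective_inv (rb n).
  by exists (h, k).
have tinj0 X (t : tensor X (D 0%N)) : tmap idfun (rho 0%N) t = 0 -> t = 0.
  move=> t0; have <- : tmap idfun k0 (tmap idfun (rho 0%N) t) = t.
    rewrite tmap_comp; apply: (tensor_ext (f := tmap _ _) (g := idfun)) => v w.
    by rewrite /= tmapE /=; congr tpure; apply: ri0; rewrite k0E.
  by rewrite t0 linear0.
have tinj X n (t : tensor X (D n.+1)) : tmap idfun (rho n.+1) t = 0 ->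
    tmap idfun (beta n) t = 0 -> t = 0.
  move=> t0 t1; have [_ _ _ _ E] := hkE n.
  have <- : tmap idfun (hk n).1 (tmap idfun (rho n.+1) t) +
      tmap idfun (hk n).2 (tmap idfun (beta n) t) = t.
    rewrite !tmap_comp.
    apply: (tensor_ext (f := tmap _ _ \+ tmap _ _) (g := idfun)) => v w.
    by rewrite /= !tmapE /= -tpureDr -E.
  by rewrite t0 t1 !linear0 addr0.
have rdT X n (t : tensor X (D n.+1)) :
    tmap idfun (rho n) (tmap idfun (cdiff D n) t) =
    tmap idfun (cdiff L n) (tmap idfun (rho n.+1) t) + a *: tmap idfun (beta n) t.
  rewrite !tmap_comp.
  apply: (tensor_ext (f := tmap _ _) (g := tmap _ _ \+ a \*: tmap _ _)) => v w.
  by rewrite /= !tmapE /= rd tpureDr tpureZr.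
have bdT X n (t : tensor X (D n.+2)) :
    tmap idfun (beta n) (tmap idfun (cdiff D n.+1) t) =
    - tmap idfun (cdiff L n) (tmap idfun (beta n.+1) t).
  rewrite !tmap_comp.
  apply: (tensor_ext (f := tmap _ _) (g := \- tmap _ _)) => v w.
  by rewrite /= !tmapE /= bd -scaleN1r tpureZr scaleN1r.
split.
- split=> [s t st|x].
    apply/eqP; rewrite -subr_eq0; apply/eqP; apply: dprod_ext => -[[k l] h].
    have l0 : l = 0%N by move: h => /=; rewrite addn_eq0 => /andP[_ /eqP].
    move: h; rewrite l0 => h; apply: tinj0.
    have e : tens_rho 0%N (s - t) = 0 by rewrite linearB /= st subrr.
    by have := tens_rhoE (s - t) (exist _ (k, 0)%N h); rewrite e.
  pose t : T 0%N := fun p =>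
    match p return tensor (G (val p).1) (D (val p).2) with
    | exist (i, 0) h => tmap idfun k0 (x (exist _ (i, 0)%N h))
    | exist (i, j.+1) h => 0
    end.
  exists t; apply: dprod_ext => -[[i [|j]] h]; rewrite tens_rhoE /=; last first.
    by exfalso; move: h; rewrite /= addnS.
  rewrite tmap_comp; apply: (tensor_ext (f := tmap _ _) (g := idfun)) => v w.
  by rewrite /= tmapE /= k0E.
- move=> n; split=> [x y|t t0 t1].
    have h' i j : (i + j.+1 == n.+1)%N -> (i + j == n)%N by rewrite addnS.
    (* In second degree 0 the cone has only its [rho] part, hence the separate case. *)
    pose t : T n.+1 := fun p =>
      match p return tensor (G (val p).1) (D (val p).2) with
      | exist (i, 0) h => tmap idfun k0 (x (exist _ (i, 0)%N h))
      | exist (i, j.+1) h =>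
          tmap idfun (hk j).1 (x (exist _ (i, j.+1)%N h)) +
          (-1) ^+ i *: tmap idfun (hk j).2 (y (exist _ (i, j)%N (h' i j h)))
      end.
    exists t; apply: dprod_ext => -[[i j] h].
      rewrite tens_rhoE; case: j h => [|j] h /=.
        by rewrite tmapK // => v; rewrite k0E.
      have [rh bh rk bk _] := hkE j.
      by rewrite linearD linearZ /= tmapK // tmap_comp tmap0r // scaler0 addr0.
    rewrite tens_betaE /=; have [rh bh rk bk _] := hkE j.
    rewrite linearD linearZ /= tmapK // tmap_comp tmap0r // add0r signK.
    exact: (bideg_irr y (q := (i, j))).
  apply: dprod_ext => -[[i [|j]] h].
    by apply: tinj0; have := tens_rhoE t (exist _ (i, 0)%N h); rewrite t0.
  apply: tinj; first by have := tens_rhoE t (exist _ (i, j.+1)%N h); rewrite t0.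
  have h' : (i + j == n)%N by move: h => /=; rewrite addnS.
  have := tens_betaE t (exist _ (i, j) h'); rewrite t1 /= => e.
  rewrite -[LHS](signK i) [t _](bideg_irr t h (shr_subproof (exist _ (i, j) h'))).
  by rewrite -e scaler0.
- move=> n t; apply: dprod_ext => -[[i j] h]; pose p : bideg n := exist _ (i, j)%N h.
  pose tl : tensor (G i.+1) (D j) := t (shl p).
  pose tr : tensor (G i) (D j.+1) := t (shr p).
  rewrite tens_rhoE -/p.
  have el : tens_rho n.+1 t (shl p) = tmap idfun (rho j) tl by exact: tens_rhoE.
  have er : tens_rho n.+1 t (shr p) = tmap idfun (rho j.+1) tr by exact: tens_rhoE.
  have eb : tens_beta n t p = (-1) ^+ i *: tmap idfun (beta j) tr by exact: tens_betaE.
  change (tmap idfun (rho j) (tens_comp tl tr) =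
    tens_comp (tens_rho n.+1 t (shl p) : tensor (G i.+1) (L j)) (tens_rho n.+1 t (shr p)) +
    a *: tens_beta n t p).
  rewrite el er eb /tens_comp tmapD tmapZ rdT tmapC -addrA; congr (_ + _).
  by rewrite scalerDr !scalerA [a * _]mulrC.
- move=> n t; apply: dprod_ext => -[[i j] h]; pose p : bideg n := exist _ (i, j)%N h.
  pose tl : tensor (G i.+1) (D j.+1) := t (shr (shl p)).
  pose tr : tensor (G i) (D j.+2) := t (shr (shr p)).
  rewrite tens_betaE.
  have el : tens_beta n.+1 t (shl p) = (-1) ^+ i.+1 *: tmap idfun (beta j) tl.
    exact: tens_betaE.
  have er : tens_beta n.+1 t (shr p) = (-1) ^+ i *: tmap idfun (beta j.+1) tr.
    exact: tens_betaE.
  have etl : t (shl (shr p)) = tl by exact: (bideg_irr t (q := (i.+1, j.+1)%N)).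
  change ((-1) ^+ i *: tmap idfun (beta j)
      (tens_comp (t (shl (shr p)) : tensor (G i.+1) (D j.+1)) tr) =
    - tens_comp (tens_beta n.+1 t (shl p) : tensor (G i.+1) (L j))
        (tens_beta n.+1 t (shr p))).
  rewrite el er etl /tens_comp !tmapD !tmapZ bdT tmapC opprD scalerDr; congr (_ + _).
    by rewrite exprS mulN1r scaleNr opprK.
  by rewrite !scalerN.
Qed.

End TensorCone.
End KoszulCone.

(** * The Koszul resolution of M/xM and the lifting forced by properness *)

Section KoszulResolution.
Variable R : comNzRingType.
Implicit Types (C T D L G : complex R) (M N V W X Y : lmodType R) (s : seq R).

Fact bideg_last_subproof n : (n + 0 == n)%N. Proof. by rewrite addn0. Qed.
Definition bideg_last n : bideg n := exist _ (n, 0)%N (bideg_last_subproof n).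

(** Only bidegree [(n, 0)] contributes, as [one_complex] is [R] in degree 0. *)
Lemma tensor_one G :
  exists rho : forall n, {linear tensor_complex G (one_complex R) n -> G n},
  [/\ forall n, injective (rho n), forall n, surjective (rho n) &
      forall n t, rho n (cdiff (tensor_complex G (one_complex R)) n t) =
        cdiff G n (rho n.+1 t)].
Proof.
set T := tensor_complex G (one_complex R).
pose isc V (f : {linear tensor V (R^o : lmodType R) -> V}) :=
  (forall v r, f (tpure v r) = r *: v) /\ (forall t, tpure (f t) (1 : R^o) = t).
have /all_sig[c cE] n : {c | isc (G n) c} := cid (tensor_regularr (G n)).
have lin n : linear (fun t : T n => c n (t (bideg_last n))).
  by move=> k s t; rewrite -linearP.
have c_inj n : injective (c n).
  by move=> s t e; rewrite -[s](cE n).2 -[t](cE n).2 e.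
have big0 n k l (h : (k + l.+1 == n)%N) (t : T n) : t (exist _ (k, l.+1) h) = 0.
  by apply: tensor_zeror => x; apply/rowP; case.
exists (fun n => mklin (lin n)); split=> n.
- move=> s t; rewrite !(mklinE (lin n)) => /c_inj st.
  apply: dprod_ext => -[[k [|l]] h]; last by rewrite !big0.
  have kn : k = n by move: h => /=; rewrite addn0 => /eqP.
  move: h; rewrite kn => h.
  have irr r := bideg_irr (r : T n) h (bideg_last_subproof n).
  by rewrite (irr s) (irr t).
- move=> v; pose t : T n := @dfwith (bideg n)
    (fun p => tensor (G (val p).1) (one_complex R (val p).2)) (fun=> 0)
    (bideg_last n) (tpure v (1 : R^o)).
  have tE : t (bideg_last n) = tpure v (1 : R^o).
    exact: (@dfwith_in (bideg n) (fun p => tensor (G (val p).1) (one_complex R (val p).2))).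
  by exists t; rewrite (mklinE (lin n)) tE (cE n).1 scale1r.
- move=> t; rewrite !(mklinE (lin _)).
  rewrite -[cdiff T n t _]/(tmap (cdiff G n) idfun (t (shl (bideg_last n))) +
    (-1) ^+ n *: tmap idfun (cdiff (one_complex R) 0) (t (shr (bideg_last n)))).
  rewrite [X in _ + _ *: X]tmap0r // scaler0 addr0.
  have -> : t (bideg_last n.+1) = t (shl (bideg_last n)) :> tensor (G n.+1) R^o.
    exact: (bideg_irr t (q := (n.+1, 0)%N)).
  apply: (tensor_ext (f := c n \o tmap (cdiff G n) idfun) (g := cdiff G n \o c n.+1)).
  by move=> v r /=; rewrite tmapE (cE n).1 (cE n.+1).1 linearZ.
Qed.

Lemma iso_exact C T N N' (e : augmentation C N) (f : {linear N -> N'})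
    (rho : forall n, {linear T n -> C n}) :
  (forall n, injective (rho n)) -> (forall n, surjective (rho n)) ->
  (forall n t, rho n (cdiff T n t) = cdiff C n (rho n.+1 t)) ->
  injective f -> surjective f -> exact_complex (augmented e) ->
  exists e' : augmentation T N', exact_complex (augmented e') /\
    forall t, e' t = f (e (rho 0%N t)).
Proof.
move=> ri rs rd fi fs [es ex].
have eK t : (f \o e \o rho 0%N) (cdiff T 0 t) = 0 by rewrite /= rd augK linear0.
exists (@Augmentation R T N' (f \o e \o rho 0%N) eK); split=> //.
split=> [v|[|n] t t0].
- have [w <-] := fs v; have [c <-] := es w; have [t <-] := rs 0%N c.
  by exists t.
- have e0 : e (rho 0%N t) = 0 by apply: fi; rewrite linear0; exact: t0.
  have [y yE] := ex 0%N (rho 0%N t) e0; have [x xE] := rs 1%N y.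
  by exists x; apply: (ri 0%N); rewrite rd xE; exact: yE.
- have t0' : cdiff C n (rho n.+1 t) = 0.
    by rewrite -rd (_ : cdiff T n t = 0) ?linear0.
  have [y yE] := ex n.+1 (rho n.+1 t) t0'; have [x xE] := rs n.+2 y.
  by exists x; apply: (ri n.+1); rewrite rd xE; exact: yE.
Qed.

Lemma qsproj_nil_inj M : injective (qsproj M [::]).
Proof.
apply: ker0_inj => v /qsproj_eq0 vS.
apply: (span_min (T := fun v => v = 0) _ _ _ vS) => // [c x y -> ->|x [b]].
  by rewrite scaler0 addr0.
by rewrite in_nil.
Qed.

Lemma koszul_exact G M (e : augmentation G M) s :
  exact_complex (augmented e) -> coregular M s ->
  exists (l : {linear tensor_complex G (koszul s) 0%N -> M})
    (e' : augmentation (tensor_complex G (koszul s)) (qseq M s)),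
    exact_complex (augmented e') /\ forall t, e' t = qsproj M s (l t).
Proof.
move=> exG; elim: s => [|a s IH].
  move=> _; have [rho [ri rs rd]] := tensor_one G.
  have qi := @qsproj_nil_inj M.
  have [e' [ex' e'E]] := iso_exact ri rs rd qi (@qsproj_surj _ M [::]) exG.
  by exists (e \o rho 0%N), e'.
move=> [na cs]; have [l [e1 [ex1 e1E]]] := IH cs.
have [rho [beta cone]] := koszul1_cone a (koszul s).
have cone' := tensor_cone G cone.
have [r [qr rE]] := qseq_modquot M s a.
have [e' [ex' e'E]] := cone_exact cone' ex1 na qr.
exists (l \o tens_rho G rho 0), e'; split=> // t.
by rewrite e'E e1E rE.
Qed.

Lemma koszul_TR G s : (forall n, TR (G n)) ->
  forall n, TR (tensor_complex G (koszul s) n).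
Proof.
move=> tG; elim: s => [|a s IH].
  move=> n; have [rho [ri rs _]] := tensor_one G.
  exact: TR_iso' (ri n) (rs n) (tG n).
have [rho [beta cone]] := koszul1_cone a (koszul s).
exact: cone_TR (tensor_cone G cone) IH.
Qed.

(* Two exact augmentations of one complex differ by an automorphism of the
   augmented module, so the lifting property does not depend on the choice. *)
Lemma TR_lifting_augmentation C M N (e e' : augmentation C N) (q : {linear M -> N})
    (l : {linear C 0%N -> M}) :
  exact_complex (augmented e) -> (forall t, e t = q (l t)) ->
  proper_G_resolution e' -> TR_lifting q.
Proof.
move=> [es ex] el [[_ [es' ex']] proper] H f tH.
have [t0|h hE] := @factor_surj _ _ _ _ e e' es.
  by move=> /(ex 0%N)[x <-]; exact: augK.
have [hs _] := proper H ((TRP H).2 tH).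
have [g gE] := hs (h \o f).
have {}gE x : e' (toLin g x) = h (f x).
  by have := congr1 (fun k => toLin k x) gE.
exists (l \o toLin g) => x; rewrite /= -el.
apply/eqP; rewrite -subr_eq0; apply/eqP.
have [t tE] := es (e (toLin g x) - f x).
have [|y yE] := ex' 0%N t.
  by rewrite -[LHS]/(e' t) -hE [e t]tE linearB /= hE gE subrr.
by rewrite -[LHS]tE -[t]yE; exact: augK.
Qed.

End KoszulResolution.

Theorem theorem2 (R : comNzRingType) (m : {pred R^o}) (M : lmodType R)
    (G : complex R) (e : augmentation G M) (x : seq R) :
  noetherian R -> local_ring m ->
  finitely_generated M ->
  (exists n, Gdim_le M n) -> ~ (exists n, pdim_le M n) ->
  bounded_complex G -> proper_G_resolution e ->
  (1 <= size x)%N -> {subset x <= m} ->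
  regular_sequence R^o x -> regular_sequence M x ->
  (exists e' : augmentation (tensor_complex G (koszul x)) (qseq M x),
     G_resolution e') /\
  ~ (exists e' : augmentation (tensor_complex G (koszul x)) (qseq M x),
       proper_G_resolution e').
Proof.
move=> nR locm /fgP fgM _ ipd [n Gn] [[tG exG] _] x1 xm _ [regx _].
have jx a : a \in x -> in_jacobson a by move=> ax; exact: local_jacobson locm (xm a ax).
have rx : regular_over M [::] x.
  by apply: regular_sequence_over => i ix; rewrite cats0; exact: regx.
have [l [e1 [ex1 e1E]]] := koszul_exact exG (regular_over_coregular nR fgM jx rx).
split.
  exists e1; split=> // k; apply/TRP/koszul_TR => j; exact/TRP/tG.
move=> [e' pe']; apply: ipd; exists n.
have lx : TR_lifting (qsproj M x) := TR_lifting_augmentation ex1 e1E pe'.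
refine (Gd_le_pdim nR (Gd_le_resolution (conj tG exG) Gn) _).
(* The descent ends at [qseq M [::]], which is isomorphic to [M]. *)
refine (TR_free_lifting_iso (@qsproj_nil_inj _ M) (@qsproj_surj _ M [::]) _).
case: x x1 {xm regx l e1 ex1 e1E e' pe'} jx rx lx => // a x _ jx rx lx.
refine (TR_free_lifting_regular nR fgM jx rx _).
(* The descent stacks the elements in reverse, which leaves the quotient unchanged. *)
move: lx; rewrite /qsproj /qseq (@seq_mul_eq _ M (a :: x) (catrev x [:: a])) //.
by move=> b; rewrite catrevE mem_cat mem_rev !inE orbC.
Qed.
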